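(* Let $r>0$, $b\neq0$, and consider the optimal control problem $$V(x_0)=\inf_{u\in\mathcal U}\int_0^\infty\{Q(x)+ru^2\}\,dt\quad\text{s.t.}\quad \dot x_1=f_1(x_1,x_2),\quad \dot x_2=f_2(x_1,x_2)+bu,\quad x(0)=x_0 .$$ Assume that there exist real scalars $a,b,c,d$ such that $$f_1(x_1,x_2)=ax_1+f(x_2),\qquad f_2(x_1,x_2)=cx_1+df(x_2),$$ where $f$ is not identically zero and is continuous with $f(0)=0$ and with a locally positive definite anti-derivative $F(x_2)$, $F'(x_2)=f(x_2)$. Assume further that $c(ad-c)\ge0$ and that for some $\beta>0$ $$\beta a^2\ge c^2\ge a^2d^2 .$$ (This implies that either $a=c=0$, or $a\ne0,c\neq0$, or $a\neq0,c=0,d=0$.) Furthermore, assume that $$Q(x)=q_1x_1^2+q_2x_2^2+q(x),$$ where $q_1\ge0$, $q_2>0$ and $$\begin{cases} q_1=q_2c^2a^{-2}+2rb^{-2}c(ad-c), & a\neq0,\\ q_1\ge q_2d^2, & a=0,\end{cases}$$ and let $q(x)$ be chosen as $$q=2rk_1k_2x_1x_2+rb^{-2}\left(k_1^2k_2^{-2}-d^2\right)f^2(x_2).$$ Then there exist gains $k_1,k_2,k$ verifying $$k_2=\sqrt{\frac{q_2}{r}},\qquad k_1=\begin{cases}-ca^{-1}k_2,& a\neq0,\\ \sqrt{q_1/r},& a=0,\end{cases}\qquad k=b^{-1}\left(d+\frac{k_1}{k_2}\right),$$ such that the control input $$u=-k_1x_1-k_2x_2-kf(x_2)$$ is a solution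 of the Hamilton-Jacobi-Bellman equation associated with the optimal control problem, with value function $$V(x)=-rb^{-1}kc\,x_1^2+rb^{-1}\left(\frac{k_1}{\sqrt{k_2}}x_1+\sqrt{k_2}\,x_2\right)^2+2rb^{-1}k\left(F(x_2)-F(0)\right).$$ The function $V(x)$ is also a local Lyapunov function for the closed-loop system provided $b>0$, $kc\le0$ and the term $kF(x_2)$ is locally positive definite, i.e., for some class $\mathcal K$ function $\delta$ and some $\gamma>0$, $$kF(x_2)\ge\delta(\|x_2\|)\quad\forall x_2\in\Omega=\{x_2:\|x_2\|\le\gamma\}.$$ If $V$ is globally positive definite and radially unbounded then it is a (global) Lyapunov function. Finally, the trajectories of the closed-loop system converge to one of the minimizers of $L(x_1,x_2,u)=Q(x)+ru^2$. If $L$ is convex, then the trajectories converge to the origin for all initial conditions.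
   Context: Here $x(t)=[x_1(t)\ x_2(t)]^T\in\mathbb R^2$; $\mathcal U$ is the set of allowable inputs, which are Lebesgue integrable functions. Standing assumptions: $V$ is of class $\mathcal C^1$, $r>0$, $b\ne0$, $Q\ge 0$, $Q(0)=0$. The Hamilton-Jacobi-Bellman (HJB) equation associated with the problem is $$\inf_u\left\{Q(x)+ru^2+V_{x_1}f_1(x_1,x_2)+V_{x_2}f_2(x_1,x_2)+V_{x_2}bu\right\}=0,\qquad V(0)=0,$$ where $V_{x_i}$ is the partial derivative of $V$ with respect to $x_i$; a control input is a solution of it (with value function $V$) if $V$ satisfies the equation and the infimum is attained at that input. The closed-loop system is the system with the stated feedback $u$ substituted; minimizers of $L$ are understood with this $u$ substituted. A Lyapunov function is a positive definite function (locally or globally) whose derivative along closed-loop trajectories is nonpositive. A class $\mathcal K$ function is a continuous strictly increasing function $\delta:[0,\cdot)\to[0,\infty)$ with $\delta(0)=0$.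
   Formalization: The last two claims (convergence) are stated under the local or global Lyapunov conditions, since unconditionally they fail; under the local ones, convergence to a minimizer is for starts near 0. Convexity of L is meant with the feedback u substituted; trajectories are those defined for all t≥0. *)

(* Defs.v *)
From Stdlib Require Import Reals.
From Coquelicot Require Import Coquelicot.

Open Scope R_scope.

(** Minimise the integral over [0, +oo) of [state_cost x + input_weight * u^2]
    subject to
    [x1' = drift1 x] and [x2' = drift2 x + input_gain * u]. *)
Record control_problem := ControlProblem {
  drift1 : R * R -> R;
  drift2 : R * R -> R;
  input_gain : R;
  state_cost : R * R -> R;
  input_weight : R
}.

Definition partial1 (V : R * R -> R) (x : R * R) : R :=
  Derive (fun s => V (s, snd x)) (fst x).

Definition partial2 (V : R * R -> R) (x : R * R) : R :=
  Derive (fun s => V (fst x, s)) (snd x).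

(* [Derive] is total, so existence of the partial derivatives is required
   separately. *)
Definition class_C1 (V : R * R -> R) : Prop :=
  forall x : R * R,
    ex_derive (fun s => V (s, snd x)) (fst x) /\
    ex_derive (fun s => V (fst x, s)) (snd x) /\
    continuous (partial1 V) x /\
    continuous (partial2 V) x.

Definition running_cost (P : control_problem) (x : R * R) (v : R) : R :=
  state_cost P x + input_weight P * v ^ 2.

Definition hamiltonian (P : control_problem) (V : R * R -> R)
    (x : R * R) (v : R) : R :=
  running_cost P x v
  + partial1 V x * drift1 P x + partial2 V x * drift2 P x
  + partial2 V x * input_gain P * v.

Definition hjb_equation (P : control_problem) (V : R * R -> R) : Prop :=
  V (0, 0) = 0 /\
  forall x : R * R,
    is_glb_Rbar (fun h => exists v : R, h = hamiltonian P V x v) (Finite 0).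

Definition hjb_solution (P : control_problem) (V u : R * R -> R) : Prop :=
  class_C1 V /\
  hjb_equation P V /\
  forall (x : R * R) (v : R),
    hamiltonian P V x (u x) <= hamiltonian P V x v.

Definition closed_loop (P : control_problem) (u : R * R -> R)
    (x : R * R) : R * R :=
  (drift1 P x, drift2 P x + input_gain P * u x).

(** [x] solves the closed-loop system on [0, T); values of [x] outside this
    interval are irrelevant, so only right-continuity is asked at 0. *)
Definition trajectory (P : control_problem) (u : R * R -> R)
    (T : Rbar) (x : R -> R * R) : Prop :=
  filterlim x (at_right 0) (locally (x 0)) /\
  forall t : R, 0 < t -> Rbar_lt t T ->
    is_derive x t (closed_loop P u (x t)).

(* The domain is [0, A); values of [delta] elsewhere are irrelevant. *)
Definition class_K (A : Rbar) (delta : R -> R) : Prop :=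
  delta 0 = 0 /\
  (forall s t : R, 0 <= s -> s < t -> Rbar_lt t A -> delta s < delta t) /\
  (forall s : R, 0 <= s -> Rbar_lt s A ->
     filterlim delta (within (fun t => 0 <= t) (locally s))
       (locally (delta s))).

Definition locally_positive_definite {E : NormedModule R_AbsRing}
    (W : E -> R) : Prop :=
  W zero = 0 /\
  exists (delta : R -> R) (A : Rbar) (gamma : R),
    class_K A delta /\ 0 < gamma /\ Rbar_lt gamma A /\
    forall x : E, norm x <= gamma -> delta (norm x) <= W x.

Definition globally_positive_definite {E : NormedModule R_AbsRing}
    (W : E -> R) : Prop :=
  W zero = 0 /\ forall x : E, x <> zero -> 0 < W x.

Definition radially_unbounded {E : NormedModule R_AbsRing}
    (W : E -> R) : Prop :=
  forall M : R, exists rho : R, forall x : E, rho < norm x -> M < W x.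

Definition nonincreasing_along_trajectories (P : control_problem)
    (u V : R * R -> R) (N : R * R -> Prop) : Prop :=
  forall (T : Rbar) (x : R -> R * R), trajectory P u T x ->
  forall t : R, 0 < t -> Rbar_lt t T -> N (x t) ->
  exists l : R, is_derive (fun s => V (x s)) t l /\ l <= 0.

Definition local_lyapunov (P : control_problem) (u V : R * R -> R) : Prop :=
  locally_positive_definite V /\
  exists N : R * R -> Prop,
    locally (0, 0) N /\ nonincreasing_along_trajectories P u V N.

Definition global_lyapunov (P : control_problem) (u V : R * R -> R) : Prop :=
  globally_positive_definite V /\
  nonincreasing_along_trajectories P u V (fun _ => True).

Definition minimizer (L : R * R -> R) (x : R * R) : Prop :=
  forall y : R * R, L x <= L y.

Definition convex_fun (L : R * R -> R) : Prop :=
  forall (x y : R * R) (theta : R), 0 <= theta <= 1 ->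
    L (plus (scal theta x) (scal (1 - theta) y))
    <= theta * L x + (1 - theta) * L y.

Definition converges_to (x : R -> R * R) (l : R * R) : Prop :=
  filterlim x (Rbar_locally p_infty) (locally l).

(* Main.v *)
(** The sign conditions give [(a d - c)^2 <= 0], hence [c = a d].  In all cases
    [k c = 0], [k1 a + k2 c = 0], [q1 = r k1^2] and [q2 = r k2^2], so completing
    the square turns the Hamiltonian into [r (v - u x)^2].

    If [a <> 0] then [k = 0] and [V] vanishes on a line, so neither set of
    stability conditions can hold.  If [a = c = 0], put [kappa = k1 / k2],
    [e = x2 + kappa x1] and [z = - kappa x1].  The closed loop decouples into
    [e' = - b k2 e] and the scalar equation [z' = - kappa f (z + e)], whose
    forcing [e] decays exponentially.  A bounded solution [z] converges to a zero
    of [f], because each level can eventually be crossed in one direction only;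
    the equilibria are exactly the zeros of the cost.  Boundedness of [x2] comes
    from [V' = - L] in the local and global cases.  If [L] is convex, the origin
    is the only zero of [f], which forces [y f(y) >= 0], and [|z|] cannot grow
    beyond the bound on [|e|]. *)

Require Import Defs.
From Stdlib Require Import Reals Lra Psatz Classical Ranalysis5.
From Coquelicot Require Import Coquelicot.

Open Scope R_scope.

(** * Scalar and planar flows *)

Lemma continuous_eps (g : R -> R) (t eps : R) :
  continuous g t -> 0 < eps ->
  exists eta, 0 < eta /\ forall s, Rabs (s - t) < eta -> Rabs (g s - g t) < eps.
Proof.
  intros Hg Heps.
  destruct (proj1 (filterlim_locally g (g t)) Hg (mkposreal eps Heps)) as [eta Heta].
  exists eta; split; [apply cond_pos|].
  intros s Hs; exact (Heta s Hs).
Qed.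

Lemma mvt_right (g dg : R -> R) (t0 s t : R) :
  (forall t, t0 <= t -> is_derive g t (dg t)) -> t0 <= s -> s <= t ->
  exists x, s <= x <= t /\ g t - g s = dg x * (t - s).
Proof.
  intros Hg Hs Ht.
  destruct (MVT_gen g s t dg) as [x [Hx E]].
  - rewrite (Rmin_left _ _ Ht), (Rmax_right _ _ Ht).
    intros x Hx; apply Hg; lra.
  - rewrite (Rmin_left _ _ Ht), (Rmax_right _ _ Ht).
    intros x Hx; apply derivable_continuous_pt.
    exists (dg x); apply is_derive_Reals, Hg; lra.
  - rewrite (Rmin_left _ _ Ht), (Rmax_right _ _ Ht) in Hx.
    exists x; split; [exact Hx | exact E].
Qed.

Lemma nonincreasing_of_derive_le0 (g dg : R -> R) (t0 : R) :
  (forall t, t0 <= t -> is_derive g t (dg t)) ->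
  (forall t, t0 <= t -> dg t <= 0) ->
  forall t, t0 <= t -> g t <= g t0.
Proof.
  intros Hg Hd t Ht.
  destruct (mvt_right g dg t0 t0 t Hg (Rle_refl _) Ht) as [x [Hx E]].
  assert (dg x <= 0) by (apply Hd; lra).
  nra.
Qed.

(** To exceed [B], the function must leave the level [B] upwards and pass through the band
    [[B, B + eta)] just after a last time at or below [B]. The mean value theorem on a short
    interval inside that band would give a positive derivative there. Because the sign is controlled
    on a band and not only at the level, the weak inequality suffices. *)
Lemma barrier_above (g dg : R -> R) (t0 B eta : R) :
  0 < eta ->
  (forall t, t0 <= t -> is_derive g t (dg t)) ->
  (forall t, t0 <= t -> B <= g t < B + eta -> dg t <= 0) ->
  g t0 <= B -> forall t, t0 <= t -> g t <= B.
Proof.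
  intros Heta Hg Hd H0 t1 Ht1.
  destruct (Rle_or_lt (g t1) B) as [|Hlt]; [assumption|exfalso].
  assert (Hc : forall t, t0 <= t -> continuous g t).
  { intros t Ht; apply (ex_derive_continuous (V := R_NormedModule)).
    exists (dg t); apply Hg, Ht. }
  (* [s] is the last time up to [t1] with [g <= B]; continuity from both sides will give
     [g s = B]. *)
  destruct (completeness (fun t => t0 <= t <= t1 /\ g t <= B)) as [s [Hub Hlub]].
  { exists t1; intros t [Ht _]; lra. }
  { exists t0; split; [lra | exact H0]. }
  assert (Hs0 : t0 <= s) by (apply Hub; split; [lra | exact H0]).
  assert (Hs1 : s <= t1) by (apply Hlub; intros t [Ht _]; lra).
  assert (Habove : forall t, s < t -> t <= t1 -> B < g t).
  { intros t Hst Htt; destruct (Rle_or_lt (g t) B) as [Hle|]; [|assumption].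
    assert (t <= s) by (apply Hub; split; [lra | exact Hle]). lra. }
  assert (HgsB : g s <= B).
  { destruct (Rle_or_lt (g s) B) as [|Hgt]; [assumption|exfalso].
    destruct (continuous_eps g s (g s - B) (Hc s Hs0)) as [e [He Hnear]]; [lra|].
    assert (s <= s - e); [|lra].
    apply Hlub; intros t [Ht HtB].
    destruct (Rle_or_lt t (s - e)) as [|Hte]; [assumption|exfalso].
    assert (t <= s) by (apply Hub; split; assumption).
    assert (Rabs (t - s) < e) by (apply Rabs_def1; lra).
    specialize (Hnear t H1); apply Rabs_def2 in Hnear; lra. }
  assert (Hst1 : s < t1) by (destruct (Req_dec s t1); [subst; lra | lra]).
  assert (HgsB' : B <= g s).
  { destruct (Rle_or_lt B (g s)) as [|Hgt]; [assumption|exfalso].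
    destruct (continuous_eps g s (B - g s) (Hc s Hs0)) as [e [He Hnear]]; [lra|].
    pose proof (Rmin_l (s + e / 2) t1); pose proof (Rmin_r (s + e / 2) t1).
    assert (s < Rmin (s + e / 2) t1) by (apply Rmin_glb_lt; lra).
    assert (HB := Habove _ H2 H1).
    assert (Hr : Rabs (Rmin (s + e / 2) t1 - s) < e) by (apply Rabs_def1; lra).
    apply Hnear, Rabs_def2 in Hr; lra. }
  (* Right after [s] the values lie above [B] but still below [B + eta], so the sign hypothesis
     applies at the mean value point. *)
  destruct (continuous_eps g s eta (Hc s Hs0) Heta) as [e [He Hnear]].
  pose proof (Rmin_l (s + e / 2) t1); pose proof (Rmin_r (s + e / 2) t1).
  assert (Hst : s < Rmin (s + e / 2) t1) by (apply Rmin_glb_lt; lra).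
  set (t := Rmin (s + e / 2) t1) in *.
  destruct (mvt_right g dg t0 s t Hg Hs0) as [x [Hx E]]; [lra|].
  assert (HB := Habove t Hst H1).
  assert (dg x <= 0); [|nra].
  apply Hd; [lra|split].
  - destruct (Req_dec x s) as [->|]; [exact HgsB'|].
    apply Rlt_le, Habove; lra.
  - assert (Hr : Rabs (x - s) < e) by (apply Rabs_def1; lra).
    apply Hnear, Rabs_def2 in Hr; lra.
Qed.

Lemma barrier_below (g dg : R -> R) (t0 B eta : R) :
  0 < eta ->
  (forall t, t0 <= t -> is_derive g t (dg t)) ->
  (forall t, t0 <= t -> B - eta < g t <= B -> 0 <= dg t) ->
  B <= g t0 -> forall t, t0 <= t -> B <= g t.
Proof.
  intros Heta Hg Hd H0 t Ht.
  assert (- g t <= - B); [|lra].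
  apply (barrier_above (fun s => - g s) (fun s => - dg s) t0 (- B) eta);
    [assumption | | | lra | assumption].
  - intros s Hs; apply (is_derive_opp (V := R_NormedModule)), Hg, Hs.
  - intros s Hs Hb; assert (0 <= dg s); [apply Hd|]; lra.
Qed.

(* The limit is sought as the limsup [p].  If [z] kept returning below
   [p - eps], it would cross every level of [(p - eps, p)] in both directions,
   although the sign of [f] near a level allows only one direction. *)
Lemma perturbed_scalar_flow_converges (f z e : R -> R) (kappa t0 B : R) :
  0 < kappa -> (forall y, continuous f y) ->
  (forall t, t0 <= t -> is_derive z t (- kappa * f (z t + e t))) ->
  is_lim e p_infty 0 ->
  (forall t, t0 <= t -> Rabs (z t) <= B) ->
  exists p, f p = 0 /\ is_lim z p_infty p.
Proof.
  intros Hkap Hf Hz He HB.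
  assert (He' : forall eps, 0 < eps ->
            exists T, t0 <= T /\ forall t, T <= t -> Rabs (e t) < eps).
  { intros eps Heps.
    apply is_lim_spec in He.
    destruct (He (mkposreal eps Heps)) as [T HT].
    exists (Rmax t0 (T + 1)); split; [apply Rmax_l|].
    intros t Ht; pose proof (Rmax_r t0 (T + 1)).
    assert (Ht' : T < t) by lra.
    specialize (HT t Ht'); simpl in HT; rewrite Rminus_0_r in HT; exact HT. }
  (* Once [e] is smaller than [nu / 2], any [z] in the band of width [nu / 2] above [m] has [z + e]
     within [nu] of [m], where [f >= 0]. Hence [z' <= 0] on the band, and late upward crossings of
     [m] are excluded. [Hsign'] is the mirror image. *)
  assert (Hsign : forall m nu, 0 < nu ->
     (forall y, Rabs (y - m) < nu -> 0 <= f y) ->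
     exists T, t0 <= T /\ forall s, T <= s -> z s <= m ->
       forall t, s <= t -> z t <= m).
  { intros m nu Hnu Hm.
    destruct (He' (nu / 2)) as [T [HT0 HT]]; [lra|].
    exists T; split; [assumption|]; intros s Hs Hzs.
    apply (barrier_above z (fun t => - kappa * f (z t + e t)) s m (nu / 2));
      [lra | | | assumption].
    - intros t Ht; apply Hz; lra.
    - intros t Ht Hzt.
      assert (Het : Rabs (e t) < nu / 2) by (apply HT; lra).
      apply Rabs_def2 in Het.
      assert (0 <= f (z t + e t)); [|nra].
      apply Hm, Rabs_def1; lra. }
  assert (Hsign' : forall m nu, 0 < nu ->
     (forall y, Rabs (y - m) < nu -> f y <= 0) ->
     exists T, t0 <= T /\ forall s, T <= s -> m <= z s ->
       forall t, s <= t -> m <= z t).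
  { intros m nu Hnu Hm.
    destruct (He' (nu / 2)) as [T [HT0 HT]]; [lra|].
    exists T; split; [assumption|]; intros s Hs Hzs.
    apply (barrier_below z (fun t => - kappa * f (z t + e t)) s m (nu / 2));
      [lra | | | assumption].
    - intros t Ht; apply Hz; lra.
    - intros t Ht Hzt.
      assert (Het : Rabs (e t) < nu / 2) by (apply HT; lra).
      apply Rabs_def2 in Het.
      assert (f (z t + e t) <= 0); [|nra].
      apply Hm, Rabs_def1; lra. }
  destruct (completeness (fun m => forall T, exists t, T < t /\ m < z t))
    as [p [Hub Hlub]].
  { exists B; intros m Hm.
    destruct (Hm t0) as [t [Ht Hmt]].
    assert (Hb : Rabs (z t) <= B) by (apply HB; lra).
    pose proof (Rle_abs (z t)); lra. }
  { exists (- B - 1); intros T.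
    exists (Rmax t0 T + 1).
    pose proof (Rmax_l t0 T); pose proof (Rmax_r t0 T).
    split; [lra|].
    assert (Hb : Rabs (z (Rmax t0 T + 1)) <= B) by (apply HB; lra).
    apply Rabs_le_between in Hb; lra. }
  assert (Hfreq : forall m, m < p -> forall T, exists t, T < t /\ m < z t).
  { intros m Hm T.
    destruct (classic (exists t, T < t /\ m < z t)) as [|Hno]; [assumption|exfalso].
    assert (p <= m); [|lra].
    apply Hlub; intros m' Hm'.
    destruct (Rle_or_lt m' m) as [|Hlt]; [assumption|exfalso].
    destruct (Hm' T) as [t [Ht Hzt]].
    apply Hno; exists t; lra. }
  assert (Hevup : forall m, p < m -> exists T, forall t, T < t -> z t <= m).
  { intros m Hm.
    destruct (classic (exists T, forall t, T < t -> z t <= m)) as [|Hno];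
      [assumption|exfalso].
    assert (m <= p); [|lra].
    apply Hub; intros T.
    destruct (classic (exists t, T < t /\ m < z t)) as [|Hno']; [assumption|exfalso].
    apply Hno; exists T; intros t Ht.
    destruct (Rle_or_lt (z t) m) as [|Hlt]; [assumption|exfalso].
    apply Hno'; exists t; lra. }
  assert (Hevlow : forall m, m < p -> exists T, forall t, T < t -> m <= z t).
  { intros m Hm.
    destruct (classic (exists T, forall t, T < t -> m <= z t)) as [|Hno];
      [assumption|exfalso].
    assert (Hfl : forall T, exists t, T < t /\ z t < m).
    { intros T.
      destruct (classic (exists t, T < t /\ z t < m)) as [|Hno']; [assumption|exfalso].
      apply Hno; exists T; intros t Ht.
      destruct (Rle_or_lt m (z t)) as [|Hlt]; [assumption|exfalso].
      apply Hno'; exists t; lra. }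
    (* If [f] is negative at some level in [(m, p)], then [z], once above that level late enough,
       never falls back below [m]. Otherwise [f >= 0] on the whole interval, and [z], once below the
       midpoint, never climbs back towards [p]. *)
    destruct (classic (exists y, m < y < p /\ f y < 0)) as [[y [Hy Hfy]]|Hnn].
    - destruct (continuous_eps f y (- f y) (Hf y)) as [nu [Hnu Hnear]]; [lra|].
      destruct (Hsign' y nu Hnu) as [T [_ HT]].
      { intros y' Hy'; apply Hnear, Rabs_def2 in Hy'; lra. }
      destruct (Hfreq y (proj2 Hy) T) as [s [Hs Hzs]].
      destruct (Hfl s) as [t [Ht Hzt]].
      assert (y <= z t) by (apply (HT s); lra). lra.
    - destruct (Hsign ((m + p) / 2) ((p - m) / 2)) as [T [_ HT]]; [lra| |].
      { intros y Hy; apply Rabs_def2 in Hy.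
        destruct (Rle_or_lt 0 (f y)) as [|Hlt]; [assumption|exfalso].
        apply Hnn; exists y; lra. }
      destruct (Hfl T) as [s [Hs Hzs]].
      destruct (Hfreq ((m + p) / 2)) with (T := s) as [t [Ht Hzt]]; [lra|].
      assert (z t <= (m + p) / 2) by (apply (HT s); lra). lra. }
  assert (Hlim : forall eps, 0 < eps ->
            exists T, forall t, T < t -> Rabs (z t - p) < eps).
  { intros eps Heps.
    destruct (Hevup (p + eps / 2)) as [T1 HT1]; [lra|].
    destruct (Hevlow (p - eps / 2)) as [T2 HT2]; [lra|].
    exists (Rmax T1 T2); intros t Ht.
    pose proof (Rmax_l T1 T2); pose proof (Rmax_r T1 T2).
    assert (z t <= p + eps / 2) by (apply HT1; lra).
    assert (p - eps / 2 <= z t) by (apply HT2; lra).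
    apply Rabs_def1; lra. }
  exists p; split.
  (* If [f p <> 0], the speed of [z] eventually exceeds [kappa * Rabs (f p) / 2], so [z] moves by
     more than that in unit time. Both ends of the unit interval are within [kappa * Rabs (f p) / 4]
     of [p], which is a contradiction. *)
  - destruct (Req_dec (f p) 0) as [|Hfp]; [assumption|exfalso].
    assert (Habs := Rabs_pos_lt _ Hfp).
    destruct (continuous_eps f p (Rabs (f p) / 2) (Hf p)) as [nu [Hnu Hnear]]; [lra|].
    assert (Hq : 0 < kappa * Rabs (f p) / 4).
    { apply Rmult_lt_0_compat; [apply Rmult_lt_0_compat|]; lra. }
    destruct (Hlim _ Hq) as [T1 HT1].
    destruct (Hlim (nu / 2)) as [T2 HT2]; [lra|].
    destruct (He' (nu / 2)) as [T3 [HT30 HT3]]; [lra|].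
    set (T := Rmax (Rmax T1 T2) T3 + 1).
    assert (HT : T1 < T /\ T2 < T /\ T3 < T).
    { pose proof (Rmax_l (Rmax T1 T2) T3); pose proof (Rmax_r (Rmax T1 T2) T3).
      pose proof (Rmax_l T1 T2); pose proof (Rmax_r T1 T2).
      unfold T; lra. }
    destruct (mvt_right z (fun t => - kappa * f (z t + e t)) t0 T (T + 1) Hz)
      as [x [Hx E]]; [lra|lra|].
    assert (A1 := HT1 T ltac:(lra)); assert (A2 := HT1 (T + 1) ltac:(lra)).
    assert (A3 := HT2 x ltac:(lra)); assert (A4 := HT3 x ltac:(lra)).
    apply Rabs_def2 in A1; apply Rabs_def2 in A2.
    apply Rabs_def2 in A3; apply Rabs_def2 in A4.
    assert (A5 : Rabs (z x + e x - p) < nu) by (apply Rabs_def1; lra).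
    apply Hnear, Rabs_def2 in A5.
    destruct (Rle_or_lt 0 (f p)) as [Hpos|Hneg].
    + rewrite (Rabs_pos_eq _ Hpos) in *; nra.
    + rewrite (Rabs_left _ Hneg) in *; nra.
  - apply is_lim_spec; intros eps.
    destruct (Hlim eps (cond_pos eps)) as [T HT].
    exists T; exact HT.
Qed.

(** The integrating factor [exp (lambda * (t - t0))] makes the product with [e] constant. *)
Lemma linear_decay (e : R -> R) (lambda t0 : R) :
  (forall t, t0 <= t -> is_derive e t (- lambda * e t)) ->
  forall t, t0 <= t -> e t = e t0 * exp (- lambda * (t - t0)).
Proof.
  intros He t Ht.
  assert (Hd : forall s, t0 <= s ->
     is_derive (fun s => e s * exp (lambda * (s - t0))) s 0).
  { intros s Hs.
    evar_last.
    apply (is_derive_mult e (fun s => exp (lambda * (s - t0))) s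
             (- lambda * e s) (lambda * exp (lambda * (s - t0)))).
    - apply He, Hs.
    - auto_derive; [trivial | unfold Rminus; ring].
    - intros; apply Rmult_comm.
    - unfold plus, mult; simpl; ring. }
  destruct (mvt_right _ (fun _ => 0) t0 t0 t Hd (Rle_refl _) Ht) as [x [_ E]].
  rewrite Rminus_diag, Rmult_0_r, exp_0, Rmult_1_r, Rmult_0_l in E.
  replace (- lambda * (t - t0)) with (- (lambda * (t - t0))) by ring.
  rewrite exp_Ropp.
  assert (Hp := exp_pos (lambda * (t - t0))).
  replace (e t0) with (e t * exp (lambda * (t - t0))) by lra.
  field; lra.
Qed.

Lemma linear_decay_lim (e : R -> R) (lambda t0 : R) :
  0 < lambda ->
  (forall t, t0 <= t -> is_derive e t (- lambda * e t)) ->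
  is_lim e p_infty 0.
Proof.
  intros Hl He.
  apply (is_lim_ext_loc (fun t => e t0 * exp (- lambda * (t - t0)))).
  { exists t0; intros t Ht; symmetry; apply (linear_decay e lambda t0 He); lra. }
  replace (Finite 0) with (Rbar_mult (e t0) 0) by (simpl; f_equal; ring).
  apply is_lim_scal_l.
  apply is_lim_comp with m_infty.
  - apply is_lim_exp_m.
  - apply is_lim_spec; intros M.
    exists (t0 - M / lambda); intros t Ht.
    assert (lambda * (- M / lambda) = - M) by (field; lra).
    nra.
  - exists 0; intros t _; discriminate.
Qed.

Lemma linear_decay_bound (e : R -> R) (lambda t0 : R) :
  0 < lambda ->
  (forall t, t0 <= t -> is_derive e t (- lambda * e t)) ->
  forall t, t0 <= t -> Rabs (e t) <= Rabs (e t0).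
Proof.
  intros Hl He t Ht.
  rewrite (linear_decay e lambda t0 He t Ht), Rabs_mult.
  rewrite (Rabs_pos_eq (exp _)) by apply Rlt_le, exp_pos.
  assert (exp (- lambda * (t - t0)) <= 1).
  { rewrite <- exp_0; apply Rnot_lt_le; intros H; apply exp_lt_inv in H; nra. }
  pose proof (Rabs_pos (e t0)); nra.
Qed.

(** The nonlinearity cancels in the combination [x2 + kappa * x1], which therefore obeys a linear
    equation. This is the decoupling on which the two planar lemmas below rest. *)
Lemma planar_error_derive (f x1 x2 : R -> R) (kappa lambda t0 : R) :
  (forall t, t0 <= t -> is_derive x1 t (f (x2 t))) ->
  (forall t, t0 <= t ->
     is_derive x2 t (- lambda * (x2 t + kappa * x1 t) - kappa * f (x2 t))) ->
  forall t, t0 <= t ->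
    is_derive (fun t => x2 t + kappa * x1 t) t (- lambda * (x2 t + kappa * x1 t)).
Proof.
  intros H1 H2 t Ht.
  evar_last.
  - apply (is_derive_plus (V := R_NormedModule)); [apply H2, Ht|].
    apply is_derive_scal, H1, Ht.
  - unfold plus; simpl; ring.
Qed.

(** With [z = - kappa * x1] one has [x2 = z + e], so [z] solves the perturbed scalar equation. It is
    bounded because both [x2] and the decaying [e] are. *)
Lemma planar_flow_converges (f x1 x2 : R -> R) (kappa lambda t0 B : R) :
  0 < kappa -> 0 < lambda -> (forall y, continuous f y) ->
  (forall t, t0 <= t -> is_derive x1 t (f (x2 t))) ->
  (forall t, t0 <= t ->
     is_derive x2 t (- lambda * (x2 t + kappa * x1 t) - kappa * f (x2 t))) ->
  (forall t, t0 <= t -> Rabs (x2 t) <= B) ->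
  exists p, f p = 0 /\ is_lim x1 p_infty (- p / kappa) /\ is_lim x2 p_infty p.
Proof.
  intros Hk Hl Hf H1 H2 HB.
  assert (He := planar_error_derive f x1 x2 kappa lambda t0 H1 H2).
  set (e := fun t => x2 t + kappa * x1 t) in He.
  assert (Hlim := linear_decay_lim e lambda t0 Hl He).
  assert (Hbnd := linear_decay_bound e lambda t0 Hl He).
  set (z := fun t => - kappa * x1 t).
  assert (Hze : forall t, z t + e t = x2 t) by (intros; unfold z, e; ring).
  destruct (perturbed_scalar_flow_converges f z e kappa t0 (B + Rabs (e t0)))
    as [p [Hp Hz]]; try assumption.
  - intros t Ht; rewrite Hze; apply is_derive_scal, H1, Ht.
  - intros t Ht.
    replace (z t) with (x2 t + - e t) by (rewrite <- Hze; ring).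
    eapply Rle_trans; [apply Rabs_triang|].
    rewrite Rabs_Ropp; specialize (HB t Ht); specialize (Hbnd t Ht); lra.
  - exists p; split; [assumption|split].
    + apply (is_lim_ext (fun t => - / kappa * z t)).
      { intros t; unfold z; field; lra. }
      replace (Finite (- p / kappa)) with (Rbar_mult (- / kappa) p)
        by (simpl; f_equal; field; lra).
      apply is_lim_scal_l, Hz.
    + apply (is_lim_ext (fun t => z t + e t)); [exact Hze|].
      replace p with (p + 0) by ring.
      apply is_lim_plus'; assumption.
Qed.

(** Since [Rabs (e t)] never exceeds [Rabs (e t0)], a value [z >= M] forces [x2 = z + e >= 0], hence
    [f (x2) >= 0] and [z' <= 0]. So [M] and, symmetrically, [- M] are barriers for [z]. *)
Lemma planar_flow_bounded (f x1 x2 : R -> R) (kappa lambda t0 : R) :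
  0 < kappa -> 0 < lambda ->
  (forall y, 0 <= y -> 0 <= f y) -> (forall y, y <= 0 -> f y <= 0) ->
  (forall t, t0 <= t -> is_derive x1 t (f (x2 t))) ->
  (forall t, t0 <= t ->
     is_derive x2 t (- lambda * (x2 t + kappa * x1 t) - kappa * f (x2 t))) ->
  exists B, forall t, t0 <= t -> Rabs (x2 t) <= B.
Proof.
  intros Hk Hl Hpos Hneg H1 H2.
  assert (He := planar_error_derive f x1 x2 kappa lambda t0 H1 H2).
  set (e := fun t => x2 t + kappa * x1 t) in He.
  assert (Hbnd := linear_decay_bound e lambda t0 Hl He).
  set (z := fun t => - kappa * x1 t).
  assert (Hze : forall t, x2 t = z t + e t) by (intros; unfold z, e; ring).
  assert (Hz : forall t, t0 <= t -> is_derive z t (- kappa * f (x2 t))).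
  { intros t Ht; apply is_derive_scal, H1, Ht. }
  set (M := Rabs (z t0) + Rabs (e t0)).
  pose proof (Rabs_pos (e t0)); pose proof (Rabs_pos (z t0)).
  assert (Hz0 : - M <= z t0 <= M).
  { unfold M; apply Rabs_le_between; lra. }
  assert (Hup : forall t, t0 <= t -> z t <= M).
  { apply (barrier_above z (fun t => - kappa * f (x2 t)) t0 M 1);
      [lra | assumption | | lra].
    intros t Ht Hzt.
    assert (0 <= f (x2 t)); [|nra].
    apply Hpos; rewrite Hze.
    specialize (Hbnd t Ht); apply Rabs_le_between in Hbnd; unfold M in Hzt; lra. }
  assert (Hlow : forall t, t0 <= t -> - M <= z t).
  { apply (barrier_below z (fun t => - kappa * f (x2 t)) t0 (- M) 1);
      [lra | assumption | | lra].
    intros t Ht Hzt.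
    assert (f (x2 t) <= 0); [|nra].
    apply Hneg; rewrite Hze.
    specialize (Hbnd t Ht); apply Rabs_le_between in Hbnd; unfold M in Hzt; lra. }
  exists (M + Rabs (e t0)); intros t Ht.
  specialize (Hbnd t Ht); apply Rabs_le_between in Hbnd.
  specialize (Hup t Ht); specialize (Hlow t Ht).
  apply Rabs_le_between; rewrite Hze; lra.
Qed.

(** * Class K functions and local positive definiteness *)

Lemma locally_positive_definite_pos {E : NormedModule R_AbsRing} (W : E -> R) :
  locally_positive_definite W ->
  exists gamma, 0 < gamma /\
    forall x : E, x <> zero -> norm x <= gamma -> 0 < W x.
Proof.
  intros [_ (delta & A & gamma & (Hd0 & Hdm & _) & Hg & HgA & HW)].
  exists gamma; split; [assumption|].
  intros x Hx Hn.
  eapply Rlt_le_trans; [|apply HW, Hn].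
  rewrite <- Hd0.
  apply Hdm; [lra | apply norm_gt_0, Hx |].
  apply Rbar_le_lt_trans with gamma; assumption.
Qed.

Lemma locally_positive_definite_ext {E : NormedModule R_AbsRing} (W W' : E -> R) :
  (forall x, W x = W' x) ->
  locally_positive_definite W -> locally_positive_definite W'.
Proof.
  intros Heq [H0 (delta & A & gamma & HK & Hg & HgA & HW)].
  split; [rewrite <- Heq; assumption|].
  exists delta, A, gamma; repeat (split; [assumption|]).
  intros x Hx; rewrite <- Heq; apply HW, Hx.
Qed.

Lemma class_K_Rmin (A : Rbar) (delta1 delta2 : R -> R) :
  class_K A delta1 -> class_K A delta2 ->
  class_K A (fun s => Rmin (delta1 s) (delta2 s)).
Proof.
  intros (H10 & H1m & H1c) (H20 & H2m & H2c); repeat split.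
  - rewrite H10, H20; apply Rmin_left; lra.
  - intros s t Hs Hst Ht.
    specialize (H1m s t Hs Hst Ht); specialize (H2m s t Hs Hst Ht).
    unfold Rmin; repeat destruct Rle_dec; lra.
  - intros s Hs HsA; apply filterlim_locally; intros eps.
    generalize (filter_and _ _
      (proj1 (filterlim_locally _ _) (H1c s Hs HsA) eps)
      (proj1 (filterlim_locally _ _) (H2c s Hs HsA) eps)).
    apply filter_imp; intros t [B1 B2].
    apply Rabs_def2 in B1; apply Rabs_def2 in B2.
    apply Rabs_def1; unfold minus, plus, opp in *; simpl in *;
      unfold Rmin; repeat destruct Rle_dec; lra.
Qed.

(** The bound [eps <= 1] keeps [eps * s] in the domain [[0, A)] of [delta]. *)
Lemma class_K_dilate (A : Rbar) (delta : R -> R) (D eps : R) :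
  0 < D -> 0 < eps <= 1 -> class_K A delta ->
  class_K A (fun s => D * delta (eps * s)).
Proof.
  intros HD Heps (H0 & Hm & Hc).
  assert (HA : forall s, 0 <= s -> Rbar_lt s A -> Rbar_lt (eps * s) A).
  { intros s Hs; apply Rbar_le_lt_trans; simpl; nra. }
  repeat split.
  - rewrite Rmult_0_r, H0; ring.
  - intros s t Hs Hst Ht; apply Rmult_lt_compat_l; [assumption|].
    apply Hm; [nra | nra | apply HA; [lra | assumption]].
  - intros s Hs HsA; apply filterlim_locally; intros nu.
    assert (Hnu : 0 < nu / D) by (apply Rdiv_lt_0_compat; [apply cond_pos | assumption]).
    assert (Heps0 : 0 <= eps * s) by nra.
    destruct (proj1 (filterlim_locally _ _) (Hc (eps * s) Heps0 (HA s Hs HsA))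
                (mkposreal _ Hnu)) as [eta Heta].
    exists eta; intros t Ht Ht0.
    assert (Hb : ball (eps * s) eta (eps * t)).
    { change (Rabs (eps * t - eps * s) < eta); change (Rabs (t - s) < eta) in Ht.
      replace (eps * t - eps * s) with (eps * (t - s)) by ring.
      rewrite Rabs_mult, (Rabs_pos_eq eps) by lra.
      pose proof (Rabs_pos (t - s)); nra. }
    assert (Heps1 : 0 <= eps * t) by nra.
    specialize (Heta _ Hb Heps1).
    change (Rabs (delta (eps * t) - delta (eps * s)) < nu / D) in Heta.
    change (Rabs (D * delta (eps * t) - D * delta (eps * s)) < nu).
    rewrite <- Rmult_minus_distr_l, Rabs_mult, (Rabs_pos_eq D) by lra.
    replace (pos nu) with (D * (nu / D)) by (field; lra).
    apply Rmult_lt_compat_l; assumption.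
Qed.

Lemma class_K_square (A : Rbar) (C : R) :
  0 < C -> class_K A (fun s => C * s ^ 2).
Proof.
  intros HC; repeat split.
  - ring.
  - intros s t Hs Hst _; assert (s ^ 2 < t ^ 2) by nra; nra.
  - intros s _ _.
    apply (filterlim_filter_le_1 (G := within (fun t => 0 <= t) (locally s))
             (F := locally s)).
    { intros P; apply filter_le_within. }
    apply (ex_derive_continuous (fun s => C * s ^ 2)); auto_derive; trivial.
Qed.

Lemma norm_pair_bounds (x y : R) :
  Rabs y <= norm (x, y) <= Rabs x + Rabs y.
Proof.
  split.
  - eapply Rle_trans; [|apply norm_prod]; apply Rmax_r.
  (* The norm on pairs unfolds to the Euclidean norm. *)
  - change (sqrt (Rabs x ^ 2 + Rabs y ^ 2) <= Rabs x + Rabs y).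
    pose proof (Rabs_pos x); pose proof (Rabs_pos y).
    rewrite <- (sqrt_pow2 (Rabs x + Rabs y)) by lra.
    apply sqrt_le_1_alt; nra.
Qed.

(* Where [x2] is small compared with [norm x], the square dominates; elsewhere
   [W] does. *)
Lemma locally_positive_definite_square_plus (W : R -> R) (C D k1 k2 : R) :
  0 < C -> 0 < D -> k1 <> 0 -> locally_positive_definite W ->
  locally_positive_definite
    (fun x : R * R => C * (k1 * fst x + k2 * snd x) ^ 2 + D * W (snd x)).
Proof.
  intros HC HD Hk1 [H0 (delta & A & gamma & HK & Hg & HgA & HW)].
  assert (Ha1 := Rabs_pos_lt _ Hk1); pose proof (Rabs_pos k2) as Ha2.
  (* With this threshold, [Rabs x2 < eps * s] gives [Rabs (k1 * x1 + k2 * x2) >= Rabs k1 * (s - eps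
     * s) - Rabs k2 * (eps * s) = Rabs k1 / 2 * s]. *)
  set (eps := Rabs k1 / (2 * (Rabs k1 + Rabs k2))).
  assert (Heq : eps * (2 * (Rabs k1 + Rabs k2)) = Rabs k1)
    by (unfold eps; field; lra).
  assert (Heps : 0 < eps <= 1).
  { split; [apply Rdiv_lt_0_compat; lra | nra]. }
  split.
  - change (C * (k1 * 0 + k2 * 0) ^ 2 + D * W 0 = 0).
    change (W 0 = 0) in H0; rewrite H0; ring.
  - exists (fun s => Rmin (C * (Rabs k1 / 2) ^ 2 * s ^ 2) (D * delta (eps * s))), A, gamma.
    split.
    { apply class_K_Rmin; [|apply class_K_dilate; assumption].
      apply class_K_square, Rmult_lt_0_compat; [assumption|].
      apply pow_lt; lra. }
    split; [assumption|split; [assumption|]].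
    intros [x1 x2] Hx; simpl fst; simpl snd.
    set (s := norm (x1, x2)) in *.
    assert (Hn : Rabs x2 <= s <= Rabs x1 + Rabs x2)
      by exact (norm_pair_bounds x1 x2).
    destruct Hn as [Hn1 Hn2].
    destruct HK as (Hd0 & Hdm & _).
    pose proof (Rabs_pos x2).
    assert (Hs0 : 0 <= s) by lra.
    assert (HWx : delta (Rabs x2) <= W x2) by (apply (HW x2); change (Rabs x2 <= gamma); lra).
    assert (HdA : Rbar_lt (Rabs x2) A).
    { apply Rbar_le_lt_trans with gamma; [simpl; lra | assumption]. }
    destruct (Rle_or_lt (eps * s) (Rabs x2)) as [Hbig|Hsmall].
    + eapply Rle_trans; [apply Rmin_r|].
      assert (delta (eps * s) <= delta (Rabs x2)).
      { destruct (Req_dec (eps * s) (Rabs x2)) as [->|]; [lra|].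
        apply Rlt_le, Hdm; [nra | lra | assumption]. }
      assert (0 <= C * (k1 * x1 + k2 * x2) ^ 2) by (pose proof (pow2_ge_0 (k1 * x1 + k2 * x2)); nra).
      nra.
    + eapply Rle_trans; [apply Rmin_l|].
      assert (0 <= W x2).
      { eapply Rle_trans; [|apply HWx].
        destruct (Req_dec (Rabs x2) 0) as [->|]; [lra|].
        rewrite <- Hd0; apply Rlt_le, Hdm; [lra | lra | assumption]. }
      assert (Hlow : Rabs k1 / 2 * s <= Rabs (k1 * x1 + k2 * x2)).
      { assert (Htri : Rabs (k1 * x1) <= Rabs (k1 * x1 + k2 * x2) + Rabs (k2 * x2)).
        { replace (k1 * x1) with ((k1 * x1 + k2 * x2) + - (k2 * x2)) at 1 by ring.
          eapply Rle_trans; [apply Rabs_triang|]; rewrite Rabs_Ropp; lra. }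
        rewrite !Rabs_mult in Htri.
        assert (Rabs k1 * (s - eps * s) <= Rabs k1 * Rabs x1)
          by (apply Rmult_le_compat_l; lra).
        assert (Rabs k2 * Rabs x2 <= Rabs k2 * (eps * s))
          by (apply Rmult_le_compat_l; lra).
        nra. }
      assert ((Rabs k1 / 2 * s) ^ 2 <= (k1 * x1 + k2 * x2) ^ 2).
      { rewrite <- (pow2_abs (k1 * x1 + k2 * x2)).
        apply pow_incr; split; [|exact Hlow].
        apply Rmult_le_pos; lra. }
      replace (C * (Rabs k1 / 2) ^ 2 * s ^ 2) with (C * (Rabs k1 / 2 * s) ^ 2) by ring.
      nra.
Qed.

(** As [F] rises from 0 to a positive value, its derivative is positive somewhere near 0. A negative
    value of [f] further right would then produce a zero in between. *)
Lemma integrand_pos_of_primitive_pos (f F : R -> R) (gamma : R) :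
  0 < gamma -> (forall y, continuous f y) -> (forall y, is_derive F y (f y)) ->
  F 0 = 0 -> (forall y, 0 < y <= gamma -> 0 < F y) ->
  (forall y, 0 < y -> f y <> 0) ->
  forall y, 0 < y -> 0 < f y.
Proof.
  intros Hg Hf HF HF0 HFpos Hnz y Hy.
  destruct (Rlt_or_le 0 (f y)) as [|Hle]; [assumption|exfalso].
  assert (Hneg : f y < 0) by (specialize (Hnz y Hy); lra).
  pose proof (Rmin_l y gamma); pose proof (Rmin_r y gamma).
  assert (Hs : 0 < Rmin y gamma) by (apply Rmin_glb_lt; assumption).
  destruct (mvt_right F f 0 0 (Rmin y gamma)) as [x [Hx E]];
    [intros; apply HF | lra | lra |].
  assert (0 < F (Rmin y gamma)) by (apply HFpos; lra).
  assert (Hfx : 0 < f x) by (rewrite HF0 in E; nra).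
  destruct (IVT_interv (fun t => - f t) x y) as [w [Hw Hfw]].
  - intros t _; apply continuity_pt_opp, continuity_pt_filterlim, Hf.
  - destruct (Req_dec x y) as [->|]; lra.
  - lra.
  - lra.
  (* The mean value point [x] may be the endpoint 0, so the zero [w] could be 0 too; then
     [x = w = 0], against [0 < f x]. *)
  - destruct (Req_dec w 0) as [->|Hw0].
    + replace x with 0 in Hfx by lra; lra.
    + apply (Hnz w); lra.
Qed.

(** * The optimal control problem *)

(** [problem], [feedback] and [value] are convertible to the local definitions [P], [u] and [V] of
    the final theorem, so lemmas stated with them transfer by conversion. *)
Definition problem (r a b c d q1 q2 k1 k2 : R) (f : R -> R) : control_problem :=
  {| drift1 := fun x => a * fst x + f (snd x);
     drift2 := fun x => c * fst x + d * f (snd x);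
     input_gain := b;
     state_cost := fun x =>
       q1 * fst x ^ 2 + q2 * snd x ^ 2
       + (2 * r * k1 * k2 * fst x * snd x
          + r * / b ^ 2 * (k1 ^ 2 * / k2 ^ 2 - d ^ 2) * f (snd x) ^ 2);
     input_weight := r |}.

Definition feedback (k1 k2 k : R) (f : R -> R) (x : R * R) : R :=
  - k1 * fst x - k2 * snd x - k * f (snd x).

Definition value (r b c k1 k2 k : R) (F : R -> R) (x : R * R) : R :=
  - r * / b * k * c * fst x ^ 2
  + r * / b * (k1 / sqrt k2 * fst x + sqrt k2 * snd x) ^ 2
  + 2 * r * / b * k * (F (snd x) - F 0).

(** The condition [k * c = 0] removes the pure [x1] term, and pulling [1 / k2] out of the square
    clears the square roots. Differentiability, positivity and growth of [V] are all read off this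
    form. *)
Lemma value_eq (r b c k1 k2 k : R) (F : R -> R) (x : R * R) :
  b <> 0 -> 0 < k2 -> k * c = 0 ->
  value r b c k1 k2 k F x =
  r / (b * k2) * (k1 * fst x + k2 * snd x) ^ 2
  + 2 * r / b * (k * (F (snd x) - F 0)).
Proof.
  intros Hb Hk2 Hkc; unfold value.
  replace (- r * / b * k * c) with (- r * / b * (k * c)) by ring; rewrite Hkc.
  assert (Hs := sqrt_lt_R0 k2 Hk2).
  replace (k1 * fst x + k2 * snd x)
    with (k1 * fst x + sqrt k2 * sqrt k2 * snd x)
    by (rewrite sqrt_sqrt by lra; reflexivity).
  replace (b * k2) with (b * (sqrt k2 * sqrt k2))
    by (rewrite sqrt_sqrt by lra; reflexivity).
  field; lra.
Qed.

Lemma value_derive1 (r b c k1 k2 k : R) (F : R -> R) (x : R * R) :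
  b <> 0 -> 0 < k2 -> k * c = 0 ->
  is_derive (fun s => value r b c k1 k2 k F (s, snd x)) (fst x)
    (2 * r / b * (k1 / k2) * (k1 * fst x + k2 * snd x)).
Proof.
  intros Hb Hk2 Hkc.
  apply (is_derive_ext (fun s => r / (b * k2) * (k1 * s + k2 * snd x) ^ 2
                        + 2 * r / b * (k * (F (snd x) - F 0)))).
  { intros s; symmetry; apply (value_eq r b c k1 k2 k F (s, snd x)); assumption. }
  auto_derive; [trivial | field; lra].
Qed.

Lemma value_derive2 (r b c k1 k2 k : R) (f F : R -> R) (x : R * R) :
  b <> 0 -> 0 < k2 -> k * c = 0 -> (forall y, is_derive F y (f y)) ->
  is_derive (fun s => value r b c k1 k2 k F (fst x, s)) (snd x)
    (2 * r / b * (k1 * fst x + k2 * snd x + k * f (snd x))).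
Proof.
  intros Hb Hk2 Hkc HF.
  apply (is_derive_ext (fun s => r / (b * k2) * (k1 * fst x + k2 * s) ^ 2
                        + 2 * r / b * (k * (F s - F 0)))).
  { intros s; symmetry; apply (value_eq r b c k1 k2 k F (fst x, s)); assumption. }
  auto_derive.
  - exists (f (snd x)); apply HF.
  - replace (Derive (fun x0 => F x0) (snd x)) with (f (snd x))
      by (symmetry; apply is_derive_unique, HF).
    field; lra.
Qed.

Lemma continuous_fst_snd_affine (g : R -> R) (A B C : R) (x : R * R) :
  (forall y, continuous g y) ->
  continuous (fun x : R * R => A * fst x + B * snd x + C * g (snd x)) x.
Proof.
  intros Hg; destruct x as [x1 x2].
  apply (continuous_plus (V := R_NormedModule)
           (fun x : R * R => A * fst x + B * snd x)
           (fun x : R * R => C * g (snd x)));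
    [apply (continuous_plus (V := R_NormedModule)
              (fun x : R * R => A * fst x) (fun x : R * R => B * snd x))|].
  - apply (continuous_scal_r (V := R_NormedModule) A (fun x : R * R => fst x)).
    apply continuous_fst.
  - apply (continuous_scal_r (V := R_NormedModule) B (fun x : R * R => snd x)).
    apply continuous_snd.
  - apply (continuous_scal_r (V := R_NormedModule) C (fun x : R * R => g (snd x))).
    apply (continuous_comp (fun x : R * R => snd x) g); [apply continuous_snd | apply Hg].
Qed.

(* Completing the square: the Hamiltonian at [v] is [r * (v - u x)^2]. *)
Lemma feedback_solves_hjb (r a b c d q1 q2 k1 k2 k : R) (f F : R -> R) :
  0 < r -> b <> 0 -> 0 < k2 -> (forall y, continuous f y) ->
  (forall y, is_derive F y (f y)) ->
  q1 = r * k1 ^ 2 -> q2 = r * k2 ^ 2 ->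
  k = / b * (d + k1 / k2) -> k * c = 0 -> k1 * a + k2 * c = 0 ->
  hjb_solution (problem r a b c d q1 q2 k1 k2 f)
    (value r b c k1 k2 k F) (feedback k1 k2 k f).
Proof.
  intros Hr Hb Hk2 Hf HF Hq1 Hq2 Hk Hkc Hac.
  assert (D1 := fun x => value_derive1 r b c k1 k2 k F x Hb Hk2 Hkc).
  assert (D2 := fun x => value_derive2 r b c k1 k2 k f F x Hb Hk2 Hkc HF).
  assert (P1 : forall x, partial1 (value r b c k1 k2 k F) x
                = 2 * r / b * (k1 / k2) * (k1 * fst x + k2 * snd x))
    by (intros x; apply is_derive_unique, D1).
  assert (P2 : forall x, partial2 (value r b c k1 k2 k F) x
                = 2 * r / b * (k1 * fst x + k2 * snd x + k * f (snd x)))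
    by (intros x; apply is_derive_unique, D2).
  assert (Hham : forall x v,
    hamiltonian (problem r a b c d q1 q2 k1 k2 f) (value r b c k1 k2 k F) x v
    = r * (v - feedback k1 k2 k f x) ^ 2).
  { intros [x1 x2] v; unfold hamiltonian, running_cost, feedback.
    rewrite P1, P2; simpl fst; simpl snd; cbn [drift1 drift2 input_gain state_cost
      input_weight problem fst snd].
    set (y := f x2).
    apply Rminus_diag_uniq.
    (* The defect in completing the square consists of two terms, one carrying the factor
       [k1 * a + k2 * c] and the other [k * c]; both factors are zero. *)
    transitivity (2 * r / b * (k1 * x1 + k2 * x2) * ((k1 * a + k2 * c) / k2) * x1
                  + 2 * r / b * (k * c) * x1 * y).
    - rewrite Hq1, Hq2, Hk; field; lra.
    - rewrite Hac, Hkc; field; lra. }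
  split; [|split; [split|]].
  - intros x; repeat split.
    + eexists; apply D1.
    + eexists; apply D2.
    + apply (continuous_ext (fun x : R * R =>
        (2 * r / b * (k1 / k2) * k1) * fst x + (2 * r / b * (k1 / k2) * k2) * snd x
        + 0 * f (snd x))).
      { intros y; rewrite P1; apply Rminus_diag_uniq; ring. }
      apply continuous_fst_snd_affine, Hf.
    + apply (continuous_ext (fun x : R * R =>
        (2 * r / b * k1) * fst x + (2 * r / b * k2) * snd x
        + (2 * r / b * k) * f (snd x))).
      { intros y; rewrite P2; apply Rminus_diag_uniq; ring. }
      apply continuous_fst_snd_affine, Hf.
  - unfold value; simpl fst; simpl snd; ring.
  - intros x; split.
    + intros h [v ->]; rewrite Hham; simpl Rbar_le.
      apply Rmult_le_pos; [lra | apply pow2_ge_0].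
    (* The infimum 0 is attained at the feedback, so every lower bound is at most 0. *)
    + intros m Hm.
      replace 0 with (hamiltonian (problem r a b c d q1 q2 k1 k2 f)
        (value r b c k1 k2 k F) x (feedback k1 k2 k f x)) by (rewrite Hham; ring).
      apply Hm; exists (feedback k1 k2 k f x); reflexivity.
  - intros x v; rewrite !Hham.
    replace (r * (feedback k1 k2 k f x - feedback k1 k2 k f x) ^ 2) with 0 by ring.
    apply Rmult_le_pos; [lra | apply pow2_ge_0].
Qed.

(** * Closed-loop dynamics and dissipation when [a = c = 0] *)

Lemma is_derive_pair (x : R -> R * R) (t : R) (l : R * R) :
  is_derive x t l ->
  is_derive (fun s => fst (x s)) t (fst l) /\ is_derive (fun s => snd (x s)) t (snd l).
Proof.
  intros Hx; split.
  - apply (filterdiff_comp' x fst t (fun y => scal y l) fst Hx).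
    apply filterdiff_linear, is_linear_fst.
  - apply (filterdiff_comp' x snd t (fun y => scal y l) snd Hx).
    apply filterdiff_linear, is_linear_snd.
Qed.

(** The choice of [k] means [b * k = d + k1 / k2]. The feedback thus cancels the drift [d * f] and
    leaves [- k1 / k2 * f], the form required by the planar flow lemmas. *)
Lemma trajectory_derive (r b d q1 q2 k1 k2 k : R) (f : R -> R) (T : Rbar)
    (x : R -> R * R) (t : R) :
  b <> 0 -> 0 < k2 -> k = / b * (d + k1 / k2) ->
  trajectory (problem r 0 b 0 d q1 q2 k1 k2 f) (feedback k1 k2 k f) T x ->
  0 < t -> Rbar_lt t T ->
  is_derive (fun s => fst (x s)) t (f (snd (x t))) /\
  is_derive (fun s => snd (x s)) t
    (- (b * k2) * (snd (x t) + k1 / k2 * fst (x t)) - k1 / k2 * f (snd (x t))).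
Proof.
  intros Hb Hk2 Hk [_ Hx] Ht HtT.
  destruct (is_derive_pair _ _ _ (Hx t Ht HtT)) as [D1 D2].
  unfold closed_loop, feedback in D1, D2; simpl in D1, D2; split.
  - evar_last; [exact D1 | ring].
  - evar_last; [exact D2 | rewrite Hk; field; lra].
Qed.

(** The cross term of the state cost completes the square of [k1 * x1 + k2 * x2]. In this form,
    nonnegativity of the cost reduces to [d ^ 2 <= (k1 / k2) ^ 2]. *)
Lemma closed_loop_cost (r b d q1 q2 k1 k2 k : R) (f : R -> R) (x : R * R) :
  b <> 0 -> 0 < k2 -> q1 = r * k1 ^ 2 -> q2 = r * k2 ^ 2 ->
  running_cost (problem r 0 b 0 d q1 q2 k1 k2 f) x (feedback k1 k2 k f x)
  = r * (k1 * fst x + k2 * snd x) ^ 2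
    + r * (((k1 / k2) ^ 2 - d ^ 2) * (f (snd x) / b) ^ 2)
    + r * (k1 * fst x + k2 * snd x + k * f (snd x)) ^ 2.
Proof.
  intros Hb Hk2 Hq1 Hq2; unfold running_cost, feedback, problem; simpl.
  rewrite Hq1, Hq2; field; lra.
Qed.

Lemma closed_loop_cost_ge0 (r b d q1 q2 k1 k2 k : R) (f : R -> R) (x : R * R) :
  0 < r -> b <> 0 -> 0 < k2 -> q1 = r * k1 ^ 2 -> q2 = r * k2 ^ 2 ->
  d ^ 2 <= (k1 / k2) ^ 2 ->
  0 <= running_cost (problem r 0 b 0 d q1 q2 k1 k2 f) x (feedback k1 k2 k f x).
Proof.
  intros Hr Hb Hk2 Hq1 Hq2 Hd; rewrite closed_loop_cost by assumption.
  apply Rplus_le_le_0_compat; [apply Rplus_le_le_0_compat|];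
    (apply Rmult_le_pos; [lra|]); [apply pow2_ge_0 | | apply pow2_ge_0].
  apply Rmult_le_pos; [lra | apply pow2_ge_0].
Qed.

(** The coefficient of the middle term may be zero, so [f (snd x) = 0] is extracted from the last
    square: once the first square vanishes, the last is a multiple of [(k * f (snd x)) ^ 2], and
    [k <> 0]. *)
Lemma closed_loop_cost_eq0 (r b d q1 q2 k1 k2 k : R) (f : R -> R) (x : R * R) :
  0 < r -> b <> 0 -> 0 < k2 -> k <> 0 -> q1 = r * k1 ^ 2 -> q2 = r * k2 ^ 2 ->
  d ^ 2 <= (k1 / k2) ^ 2 ->
  running_cost (problem r 0 b 0 d q1 q2 k1 k2 f) x (feedback k1 k2 k f x) <= 0 <->
  k1 * fst x + k2 * snd x = 0 /\ f (snd x) = 0.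
Proof.
  intros Hr Hb Hk2 Hk0 Hq1 Hq2 Hd; rewrite closed_loop_cost by assumption.
  set (z := k1 * fst x + k2 * snd x); set (y := f (snd x)).
  split.
  - intros H.
    assert (0 <= r * (((k1 / k2) ^ 2 - d ^ 2) * (y / b) ^ 2)).
    { apply Rmult_le_pos; [lra|].
      apply Rmult_le_pos; [lra | apply pow2_ge_0]. }
    pose proof (pow2_ge_0 z); pose proof (pow2_ge_0 (z + k * y)).
    assert (Hz : z = 0).
    { apply Rsqr_0_uniq; rewrite Rsqr_pow2; nra. }
    split; [exact Hz|].
    assert (Hy : z + k * y = 0).
    { apply Rsqr_0_uniq; rewrite Rsqr_pow2; nra. }
    rewrite Hz, Rplus_0_l in Hy.
    destruct (Rmult_integral _ _ Hy); [contradiction | assumption].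
  - intros [-> ->]; apply Req_le; field; lra.
Qed.

(** This dissipation identity says that the Hamiltonian vanishes at the optimal input. It is
    obtained here by the chain rule, with the cost written as a sum of squares. *)
Lemma value_derive_along_trajectory (r b d q1 q2 k1 k2 k : R) (f F : R -> R)
    (T : Rbar) (x : R -> R * R) (t : R) :
  b <> 0 -> 0 < k2 -> q1 = r * k1 ^ 2 -> q2 = r * k2 ^ 2 ->
  k = / b * (d + k1 / k2) -> (forall y, is_derive F y (f y)) ->
  trajectory (problem r 0 b 0 d q1 q2 k1 k2 f) (feedback k1 k2 k f) T x ->
  0 < t -> Rbar_lt t T ->
  is_derive (fun s => value r b 0 k1 k2 k F (x s)) t
    (- running_cost (problem r 0 b 0 d q1 q2 k1 k2 f) (x t)
         (feedback k1 k2 k f (x t))).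
Proof.
  intros Hb Hk2 Hq1 Hq2 Hk HF Hx Ht HtT.
  destruct (trajectory_derive r b d q1 q2 k1 k2 k f T x t Hb Hk2 Hk Hx Ht HtT)
    as [D1 D2].
  apply (is_derive_ext (fun s =>
    r / (b * k2) * (k1 * fst (x s) + k2 * snd (x s)) ^ 2
    + 2 * r / b * (k * (F (snd (x s)) - F 0)))).
  { intros s; symmetry; apply value_eq; [assumption | assumption | ring]. }
  rewrite closed_loop_cost by assumption.
  set (y1 := fun s => fst (x s)) in *; set (y2 := fun s => snd (x s)) in *.
  change (is_derive (fun s => r / (b * k2) * (k1 * y1 s + k2 * y2 s) ^ 2
    + 2 * r / b * (k * (F (y2 s) - F 0))) t
    (- (r * (k1 * y1 t + k2 * y2 t) ^ 2
    + r * (((k1 / k2) ^ 2 - d ^ 2) * (f (y2 t) / b) ^ 2)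
    + r * (k1 * y1 t + k2 * y2 t + k * f (y2 t)) ^ 2))).
  change (snd (x t)) with (y2 t) in D1, D2; change (fst (x t)) with (y1 t) in D2.
  auto_derive.
  - repeat split; eexists; [exact D1 | exact D2 | apply HF | exact D2].
  - replace (Derive (fun s => y1 s) t) with (f (y2 t))
      by (symmetry; apply is_derive_unique, D1).
    replace (Derive (fun s => y2 s) t)
      with (- (b * k2) * (y2 t + k1 / k2 * y1 t) - k1 / k2 * f (y2 t))
      by (symmetry; apply is_derive_unique, D2).
    replace (Derive (fun s => F s) (y2 t)) with (f (y2 t))
      by (symmetry; apply is_derive_unique, HF).
    rewrite Hk; field; lra.
Qed.

Lemma value_nonincreasing (r b d q1 q2 k1 k2 k : R) (f F : R -> R) :
  0 < r -> b <> 0 -> 0 < k2 -> q1 = r * k1 ^ 2 -> q2 = r * k2 ^ 2 ->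
  k = / b * (d + k1 / k2) -> d ^ 2 <= (k1 / k2) ^ 2 ->
  (forall y, is_derive F y (f y)) ->
  nonincreasing_along_trajectories (problem r 0 b 0 d q1 q2 k1 k2 f)
    (feedback k1 k2 k f) (value r b 0 k1 k2 k F) (fun _ => True).
Proof.
  intros Hr Hb Hk2 Hq1 Hq2 Hk Hd HF T x Hx t Ht HtT _.
  eexists; split.
  - apply (value_derive_along_trajectory r b d q1 q2 k1 k2 k f F T x t); assumption.
  - apply Ropp_le_cancel; rewrite Ropp_0, Ropp_involutive.
    apply closed_loop_cost_ge0; assumption.
Qed.

Lemma value_antitone (r b d q1 q2 k1 k2 k : R) (f F : R -> R) (x : R -> R * R)
    (t0 : R) :
  0 < r -> b <> 0 -> 0 < k2 -> q1 = r * k1 ^ 2 -> q2 = r * k2 ^ 2 ->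
  k = / b * (d + k1 / k2) -> d ^ 2 <= (k1 / k2) ^ 2 ->
  (forall y, is_derive F y (f y)) ->
  trajectory (problem r 0 b 0 d q1 q2 k1 k2 f) (feedback k1 k2 k f) p_infty x ->
  0 < t0 ->
  forall t, t0 <= t ->
    value r b 0 k1 k2 k F (x t) <= value r b 0 k1 k2 k F (x t0).
Proof.
  intros Hr Hb Hk2 Hq1 Hq2 Hk Hd HF Hx Ht0.
  apply (nonincreasing_of_derive_le0 (fun s => value r b 0 k1 k2 k F (x s))
    (fun t => - running_cost (problem r 0 b 0 d q1 q2 k1 k2 f) (x t)
                  (feedback k1 k2 k f (x t)))).
  - intros t Ht.
    apply (value_derive_along_trajectory r b d q1 q2 k1 k2 k f F p_infty x t);
      try assumption; [lra | exact I].
  - intros t Ht; apply Ropp_le_cancel; rewrite Ropp_0, Ropp_involutive.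
    apply closed_loop_cost_ge0; assumption.
Qed.

(** * Boundedness of trajectories and convergence to minimizers *)

Lemma converges_to_pair (x : R -> R * R) (l1 l2 : R) :
  is_lim (fun t => fst (x t)) p_infty l1 -> is_lim (fun t => snd (x t)) p_infty l2 ->
  converges_to x (l1, l2).
Proof.
  intros H1 H2; apply filterlim_locally; intros eps.
  generalize (filter_and _ _ (proj1 (filterlim_locally _ l1) H1 eps)
                             (proj1 (filterlim_locally _ l2) H2 eps)).
  apply filter_imp; intros t [B1 B2]; split; assumption.
Qed.

(** The local, global and convex cases all end here, differing only in how they bound [x2]. *)
Lemma bounded_trajectory_converges (r b d q1 q2 k1 k2 k : R) (f : R -> R)
    (x : R -> R * R) (t0 B : R) :
  0 < b -> 0 < k1 -> 0 < k2 -> k = / b * (d + k1 / k2) ->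
  (forall y, continuous f y) ->
  trajectory (problem r 0 b 0 d q1 q2 k1 k2 f) (feedback k1 k2 k f) p_infty x ->
  0 < t0 -> (forall t, t0 <= t -> Rabs (snd (x t)) <= B) ->
  exists p, f p = 0 /\ converges_to x (- p / (k1 / k2), p).
Proof.
  intros Hb Hk1 Hk2 Hk Hf Hx Ht0 HB.
  assert (Hb0 : b <> 0) by lra.
  assert (D := fun t Ht => trajectory_derive r b d q1 q2 k1 k2 k f p_infty x t
                             Hb0 Hk2 Hk Hx Ht I).
  destruct (planar_flow_converges f (fun t => fst (x t)) (fun t => snd (x t))
              (k1 / k2) (b * k2) t0 B) as [p (Hp & L1 & L2)]; try assumption.
  - apply Rdiv_lt_0_compat; assumption.
  - apply Rmult_lt_0_compat; assumption.
  - intros t Ht; apply D; lra.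
  - intros t Ht; apply D; lra.
  - exists p; split; [assumption | apply converges_to_pair; assumption].
Qed.

(** To leave the strip, the trajectory must meet its edge. There [V] is at least [2 * r / b * m],
    because its square term is nonnegative, but [V] started below this level and cannot increase. *)
Lemma trajectory_in_strip (r b d q1 q2 k1 k2 k gamma m t0 : R) (f F : R -> R)
    (x : R -> R * R) :
  0 < r -> 0 < b -> 0 < k2 -> q1 = r * k1 ^ 2 -> q2 = r * k2 ^ 2 ->
  k = / b * (d + k1 / k2) -> d ^ 2 <= (k1 / k2) ^ 2 ->
  (forall y, is_derive F y (f y)) -> F 0 = 0 ->
  (forall y, Rabs y = gamma -> m <= k * F y) ->
  trajectory (problem r 0 b 0 d q1 q2 k1 k2 f) (feedback k1 k2 k f) p_infty x ->
  0 < t0 -> Rabs (snd (x t0)) < gamma ->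
  value r b 0 k1 k2 k F (x t0) < 2 * r / b * m ->
  forall t, t0 <= t -> Rabs (snd (x t)) <= gamma.
Proof.
  intros Hr Hb Hk2 Hq1 Hq2 Hk Hd HF HF0 Hm Hx Ht0 Hin HV t Ht.
  assert (Hb0 : b <> 0) by lra.
  destruct (Rle_or_lt (Rabs (snd (x t))) gamma) as [|Hout]; [assumption|exfalso].
  destruct (IVT_interv (fun s => Rabs (snd (x s)) - gamma) t0 t) as [s [Hs E]].
  - intros s Hs; apply continuity_pt_minus.
    + apply continuity_pt_filterlim.
      apply (continuous_Rabs_comp (fun s => snd (x s))).
      apply (ex_derive_continuous (V := R_NormedModule)); eexists.
      apply (trajectory_derive r b d q1 q2 k1 k2 k f p_infty x s); try assumption;
        [lra | exact I].
    + apply continuity_pt_const; intros ? ?; reflexivity.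
  - destruct (Req_dec t0 t) as [->|]; lra.
  - lra.
  - lra.
  - assert (Hdec := value_antitone r b d q1 q2 k1 k2 k f F x t0 Hr Hb0 Hk2 Hq1 Hq2
                      Hk Hd HF Hx Ht0 s (proj1 Hs)).
    rewrite (value_eq r b 0 k1 k2 k F (x s)) in Hdec by (assumption || ring).
    rewrite HF0, Rminus_0_r in Hdec.
    assert (0 <= r / (b * k2) * (k1 * fst (x s) + k2 * snd (x s)) ^ 2).
    { apply Rmult_le_pos; [|apply pow2_ge_0].
      apply Rlt_le, Rdiv_lt_0_compat; [assumption|].
      apply Rmult_lt_0_compat; assumption. }
    assert (2 * r / b * m <= 2 * r / b * (k * F (snd (x s)))).
    { apply Rmult_le_compat_l; [|apply Hm; lra].
      apply Rlt_le, Rdiv_lt_0_compat; lra. }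
    lra.
Qed.

Lemma value_continuous (r b k1 k2 k : R) (f F : R -> R) (x : R * R) :
  b <> 0 -> 0 < k2 -> (forall y, is_derive F y (f y)) ->
  continuous (value r b 0 k1 k2 k F) x.
Proof.
  intros Hb Hk2 HF.
  assert (HFc : forall y, continuous F y).
  { intros y; apply (ex_derive_continuous (V := R_NormedModule)).
    exists (f y); apply HF. }
  (* The square is split into a product of two affine forms, padded with zero terms so that
     [continuous_fst_snd_affine] covers every factor. *)
  apply (continuous_ext (fun x : R * R =>
    (k1 * fst x + k2 * snd x + 0 * F (snd x))
      * (r / (b * k2) * k1 * fst x + r / (b * k2) * k2 * snd x + 0 * F (snd x))
    + (0 * fst x + 0 * snd x + 2 * r / b * k * (F (snd x) - F 0)))).
  { intros y; rewrite value_eq by (assumption || ring).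
    apply Rminus_diag_uniq; ring. }
  apply (continuous_plus (V := R_NormedModule)
    (fun x : R * R => (k1 * fst x + k2 * snd x + 0 * F (snd x))
      * (r / (b * k2) * k1 * fst x + r / (b * k2) * k2 * snd x + 0 * F (snd x)))).
  - apply (continuous_mult (K := R_AbsRing)); apply continuous_fst_snd_affine, HFc.
  - apply (continuous_fst_snd_affine (fun y => F y - F 0)); intros y.
    apply (continuous_minus (V := R_NormedModule)); [apply HFc | apply continuous_const].
Qed.

Lemma equilibrium_minimizes_cost (r b d q1 q2 k1 k2 k p : R) (f : R -> R) :
  0 < r -> 0 < b -> 0 < k1 -> 0 < k2 -> k <> 0 ->
  q1 = r * k1 ^ 2 -> q2 = r * k2 ^ 2 -> d ^ 2 <= (k1 / k2) ^ 2 -> f p = 0 ->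
  minimizer (fun x => running_cost (problem r 0 b 0 d q1 q2 k1 k2 f) x
                        (feedback k1 k2 k f x)) (- p / (k1 / k2), p).
Proof.
  intros Hr Hb Hk1 Hk2 Hk Hq1 Hq2 Hd Hp y.
  assert (Hb0 : b <> 0) by lra.
  eapply Rle_trans; [|apply closed_loop_cost_ge0; assumption].
  apply closed_loop_cost_eq0; try assumption.
  split; [simpl; field; lra | exact Hp].
Qed.

(* Convexity makes the zero set of the cost, hence of [f], star-shaped about 0;
   positive definiteness of [F] then leaves only the zero at the origin. *)
Lemma convex_cost_integrand_zero (r b d q1 q2 k1 k2 k y : R) (f F : R -> R) :
  0 < r -> 0 < b -> 0 < k1 -> 0 < k2 -> k <> 0 ->
  q1 = r * k1 ^ 2 -> q2 = r * k2 ^ 2 -> d ^ 2 <= (k1 / k2) ^ 2 ->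
  (forall y, is_derive F y (f y)) -> f 0 = 0 -> locally_positive_definite F ->
  convex_fun (fun x => running_cost (problem r 0 b 0 d q1 q2 k1 k2 f) x
                         (feedback k1 k2 k f x)) ->
  f y = 0 -> y = 0.
Proof.
  intros Hr Hb Hk1 Hk2 Hk Hq1 Hq2 Hd HF Hf0 HFl Hconv Hfy.
  assert (Hb0 : b <> 0) by lra.
  set (L := fun x => running_cost (problem r 0 b 0 d q1 q2 k1 k2 f) x
                         (feedback k1 k2 k f x)) in Hconv.
  assert (HL : forall x, L x <= 0 <-> k1 * fst x + k2 * snd x = 0 /\ f (snd x) = 0).
  { intros x; apply closed_loop_cost_eq0; assumption. }
  assert (Hseg : forall theta, 0 <= theta <= 1 -> f (theta * y) = 0).
  { intros theta Hth.
    assert (H := Hconv (- y / (k1 / k2), y) (0, 0) theta Hth).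
    assert (L1 : L (- y / (k1 / k2), y) <= 0).
    { apply HL; split; [simpl; field; lra | exact Hfy]. }
    assert (L2 : L (0, 0) <= 0).
    { apply HL; split; [simpl; ring | exact Hf0]. }
    assert (Hle : L (plus (scal theta (- y / (k1 / k2), y)) (scal (1 - theta) (0, 0)))
                  <= 0) by nra.
    apply HL in Hle; destruct Hle as [_ Hle].
    replace (theta * y) with (theta * y + (1 - theta) * 0) by ring; exact Hle. }
  destruct (Req_dec y 0) as [|Hy]; [assumption|exfalso].
  destruct (locally_positive_definite_pos F HFl) as [gamma [Hg HFpos]].
  destruct HFl as [HF0 _]; change (F 0 = 0) in HF0.
  assert (Ha := Rabs_pos_lt y Hy).
  (* This factor shrinks [y] into the range where [F] is known to be positive. *)
  set (theta := Rmin 1 (gamma / Rabs y)).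
  assert (Hth : 0 < theta <= 1).
  { split; [|apply Rmin_l].
    apply Rmin_glb_lt; [lra | apply Rdiv_lt_0_compat; assumption]. }
  assert (Hpos : 0 < F (theta * y)).
  { apply HFpos.
    - intros E; apply Rmult_integral in E; destruct E; lra.
    - change (Rabs (theta * y) <= gamma).
      rewrite Rabs_mult, (Rabs_pos_eq theta) by lra.
      replace gamma with (gamma / Rabs y * Rabs y) by (field; lra).
      apply Rmult_le_compat_r; [lra | apply Rmin_r]. }
  (* Since [f] vanishes on the segment, [F] is constant along it, so [F (theta * y) = F 0 = 0]. *)
  destruct (mvt_right (fun s => F (s * y)) (fun s => y * f (s * y)) 0 0 theta)
    as [s [Hs E]]; [| lra | lra |].
  - intros s _.
    apply (is_derive_comp F (fun s => s * y) s (f (s * y)) y); [apply HF|].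
    auto_derive; [trivial | ring].
  - rewrite Rmult_0_l, HF0, Hseg in E by lra; lra.
Qed.

Lemma integrand_sector (f F : R -> R) :
  (forall y, continuous f y) -> (forall y, is_derive F y (f y)) ->
  locally_positive_definite F -> f 0 = 0 -> (forall y, f y = 0 -> y = 0) ->
  (forall y, 0 <= y -> 0 <= f y) /\ (forall y, y <= 0 -> f y <= 0).
Proof.
  intros Hf HF HFl Hf0 Hz.
  destruct (locally_positive_definite_pos F HFl) as [gamma [Hg HFpos]].
  destruct HFl as [HF0 _]; change (F 0 = 0) in HF0.
  assert (HFpos' : forall y, y <> 0 -> Rabs y <= gamma -> 0 < F y) by exact HFpos.
  split; intros y Hy; (destruct (Req_dec y 0) as [->|Hy0]; [lra|]).
  - apply Rlt_le, (integrand_pos_of_primitive_pos f F gamma); try assumption; try lra.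
    + intros s Hs; apply HFpos'; [|rewrite Rabs_pos_eq]; lra.
    + intros s Hs E; apply Hz in E; lra.
  (* The negative half-line follows by reflection: [- f (- s)] has the primitive [F (- s)]. *)
  - assert (0 < - f (- - y)); [|rewrite Ropp_involutive in *; lra].
    apply (integrand_pos_of_primitive_pos (fun s => - f (- s)) (fun s => F (- s)) gamma);
      try assumption; try lra.
    + intros s; apply (continuous_opp (V := R_NormedModule)).
      apply (continuous_comp (fun s => - s) f); [|apply Hf].
      apply (continuous_opp (V := R_NormedModule)), continuous_id.
    + intros s; evar_last.
      * apply (is_derive_comp F (fun s => - s) s (f (- s)) (-1)); [apply HF|].
        auto_derive; [trivial | ring].
      * unfold scal; simpl; unfold mult; simpl; ring.
    + rewrite Ropp_0; exact HF0.
    + intros s Hs; apply HFpos'; [|rewrite Rabs_Ropp, Rabs_pos_eq]; lra.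
    + intros s Hs E; assert (E' : f (- s) = 0) by lra; apply Hz in E'; lra.
Qed.

Lemma value_locally_positive_definite (r b k1 k2 k : R) (F : R -> R) :
  0 < r -> 0 < b -> 0 < k1 -> 0 < k2 -> F 0 = 0 ->
  locally_positive_definite (fun y => k * F y) ->
  locally_positive_definite (value r b 0 k1 k2 k F).
Proof.
  intros Hr Hb Hk1 Hk2 HF0 HkF.
  apply (locally_positive_definite_ext (E := prod_NormedModule _ R_NormedModule R_NormedModule)
    (fun x : R * R => r / (b * k2) * (k1 * fst x + k2 * snd x) ^ 2
                      + 2 * r / b * (k * F (snd x)))).
  - intros x; rewrite value_eq, HF0, Rminus_0_r by (lra || ring); reflexivity.
  - apply (locally_positive_definite_square_plus (fun y => k * F y));
      [| | lra | assumption].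
    + apply Rdiv_lt_0_compat; [|apply Rmult_lt_0_compat]; assumption.
    + apply Rdiv_lt_0_compat; lra.
Qed.

(** The class K bound at [gamma] supplies a positive level that [k * F] reaches on the edges of the
    strip of half-width [gamma]. Starting points with smaller [V] are trapped in the strip. *)
Lemma local_convergence (r b d q1 q2 k1 k2 k : R) (f F : R -> R) :
  0 < r -> 0 < b -> 0 < k1 -> 0 < k2 -> q1 = r * k1 ^ 2 -> q2 = r * k2 ^ 2 ->
  k = / b * (d + k1 / k2) -> d ^ 2 <= (k1 / k2) ^ 2 ->
  (forall y, continuous f y) -> (forall y, is_derive F y (f y)) -> F 0 = 0 ->
  locally_positive_definite (fun y => k * F y) ->
  locally (0, 0) (fun x0 : R * R => forall x,
    trajectory (problem r 0 b 0 d q1 q2 k1 k2 f) (feedback k1 k2 k f) p_infty x ->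
    x 0 = x0 ->
    exists p, f p = 0 /\ converges_to x (- p / (k1 / k2), p)).
Proof.
  intros Hr Hb Hk1 Hk2 Hq1 Hq2 Hk Hd Hf HF HF0
    [_ (delta & A & gamma & (Hd0 & Hdm & _) & Hg & HgA & Hlow)].
  assert (Hb0 : b <> 0) by lra.
  assert (Hm : 0 < delta gamma) by (rewrite <- Hd0; apply Hdm; [lra | lra | assumption]).
  set (V := value r b 0 k1 k2 k F).
  set (N := fun x : R * R => Rabs (snd x) < gamma /\ V x < 2 * r / b * delta gamma).
  assert (HN : locally (0, 0) N).
  { apply (filter_and (fun x : R * R => Rabs (snd x) < gamma)
             (fun x => V x < 2 * r / b * delta gamma)).
    - exists (mkposreal _ Hg); intros y [_ Hy]; simpl in Hy.
      change (Rabs (snd y - 0) < gamma) in Hy; rewrite Rminus_0_r in Hy; exact Hy.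
    - assert (HV0 : V (0, 0) = 0) by (unfold V, value; simpl; ring).
      assert (Heps : 0 < 2 * r / b * delta gamma).
      { apply Rmult_lt_0_compat; [apply Rdiv_lt_0_compat; lra | assumption]. }
      generalize (proj1 (filterlim_locally _ _)
        (value_continuous r b k1 k2 k f F (0, 0) Hb0 Hk2 HF) (mkposreal _ Heps)).
      apply filter_imp; intros y Hy.
      change (Rabs (V y - V (0, 0)) < 2 * r / b * delta gamma) in Hy.
      rewrite HV0, Rminus_0_r in Hy; apply Rabs_def2 in Hy; lra. }
  (* [N] is needed on a whole neighbourhood of [x0], since the trajectory at small positive times is
     only known to be close to [x0]. *)
  generalize (locally_locally _ _ HN); apply filter_imp; intros x0 HNx0 x Hx Hx0.
  (* Differentiability is only available for t > 0, so the flow is followed from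
     a small positive time at which it is still in [N]. *)
  assert (Hstart : at_right 0 (fun t => N (x t))).
  { apply (proj1 Hx); rewrite Hx0; exact HNx0. }
  destruct Hstart as [eta Heta].
  assert (Hpos := cond_pos eta).
  assert (Hball : ball 0 eta (eta / 2)).
  { change (Rabs (eta / 2 - 0) < eta); apply Rabs_def1; lra. }
  assert (Ht0 : 0 < eta / 2) by lra.
  destruct (Heta (eta / 2) Hball Ht0) as [N1 N2].
  apply (bounded_trajectory_converges r b d q1 q2 k1 k2 k f x (eta / 2) gamma);
    try assumption.
  apply (trajectory_in_strip r b d q1 q2 k1 k2 k gamma (delta gamma) (eta / 2) f F x);
    try assumption.
  intros y Hy.
  replace (delta gamma) with (delta (norm (y : R_NormedModule)));
    [| change (delta (Rabs y) = delta gamma); rewrite Hy; reflexivity].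
  apply Hlow; change (Rabs y <= gamma); lra.
Qed.

(** Radial unboundedness bounds the sublevel set of [V] through the point reached at time 1, and the
    trajectory stays in that set afterwards. *)
Lemma global_convergence (r b d q1 q2 k1 k2 k : R) (f F : R -> R) (x : R -> R * R) :
  0 < r -> 0 < b -> 0 < k1 -> 0 < k2 -> q1 = r * k1 ^ 2 -> q2 = r * k2 ^ 2 ->
  k = / b * (d + k1 / k2) -> d ^ 2 <= (k1 / k2) ^ 2 ->
  (forall y, continuous f y) -> (forall y, is_derive F y (f y)) ->
  radially_unbounded (value r b 0 k1 k2 k F) ->
  trajectory (problem r 0 b 0 d q1 q2 k1 k2 f) (feedback k1 k2 k f) p_infty x ->
  exists p, f p = 0 /\ converges_to x (- p / (k1 / k2), p).
Proof.
  intros Hr Hb Hk1 Hk2 Hq1 Hq2 Hk Hd Hf HF Hrad Hx.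
  assert (Hb0 : b <> 0) by lra.
  destruct (Hrad (value r b 0 k1 k2 k F (x 1))) as [rho Hrho].
  apply (bounded_trajectory_converges r b d q1 q2 k1 k2 k f x 1 rho);
    try assumption; [lra|].
  intros t Ht.
  assert (HV := value_antitone r b d q1 q2 k1 k2 k f F x 1 Hr Hb0 Hk2 Hq1 Hq2 Hk Hd
                  HF Hx Rlt_0_1 t Ht).
  destruct (Rle_or_lt (Rabs (snd (x t))) rho) as [|Hlt]; [assumption|exfalso].
  specialize (Hrho (x t)).
  destruct (x t) as [y1 y2].
  assert (rho < norm (y1, y2)) by (pose proof (norm_pair_bounds y1 y2); simpl in Hlt; lra).
  specialize (Hrho H); lra.
Qed.

Lemma convex_cost_convergence (r b d q1 q2 k1 k2 k : R) (f F : R -> R)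
    (x : R -> R * R) :
  0 < r -> 0 < b -> 0 < k1 -> 0 < k2 -> k <> 0 ->
  q1 = r * k1 ^ 2 -> q2 = r * k2 ^ 2 ->
  k = / b * (d + k1 / k2) -> d ^ 2 <= (k1 / k2) ^ 2 ->
  (forall y, continuous f y) -> (forall y, is_derive F y (f y)) -> f 0 = 0 ->
  locally_positive_definite F ->
  convex_fun (fun x => running_cost (problem r 0 b 0 d q1 q2 k1 k2 f) x
                         (feedback k1 k2 k f x)) ->
  trajectory (problem r 0 b 0 d q1 q2 k1 k2 f) (feedback k1 k2 k f) p_infty x ->
  converges_to x (0, 0).
Proof.
  intros Hr Hb Hk1 Hk2 Hk0 Hq1 Hq2 Hk Hd Hf HF Hf0 HFl Hconv Hx.
  assert (Hb0 : b <> 0) by lra.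
  assert (Hzero : forall y, f y = 0 -> y = 0).
  { intros y; apply (convex_cost_integrand_zero r b d q1 q2 k1 k2 k y f F); assumption. }
  destruct (integrand_sector f F Hf HF HFl Hf0 Hzero) as [Hpos Hneg].
  assert (D := fun t Ht => trajectory_derive r b d q1 q2 k1 k2 k f p_infty x t
                             Hb0 Hk2 Hk Hx Ht I).
  destruct (planar_flow_bounded f (fun t => fst (x t)) (fun t => snd (x t))
              (k1 / k2) (b * k2) 1) as [B HB]; try assumption.
  - apply Rdiv_lt_0_compat; assumption.
  - apply Rmult_lt_0_compat; assumption.
  - intros t Ht; apply D; lra.
  - intros t Ht; apply D; lra.
  - destruct (bounded_trajectory_converges r b d q1 q2 k1 k2 k f x 1 B)
      as [p [Hp Hlim]]; try assumption; [lra|].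
    apply Hzero in Hp; rewrite Hp in Hlim.
    replace (- 0 / (k1 / k2)) with 0 in Hlim by (field; lra); exact Hlim.
Qed.

(** * Nonzero gains, the sign of [b] and algebraic identities *)

Lemma gain_nonzero_of_locally_positive_definite (k : R) (F : R -> R) :
  locally_positive_definite (fun y => k * F y) -> k <> 0.
Proof.
  intros HkF ->.
  destruct (locally_positive_definite_pos _ HkF) as [gamma [Hg Hpos]].
  assert (0 < 0 * F gamma); [|lra].
  apply (Hpos gamma).
  - change (gamma <> 0); lra.
  - change (Rabs gamma <= gamma); rewrite Rabs_pos_eq; lra.
Qed.

(* With [k = 0], [value] vanishes on the line [k1 x1 + k2 x2 = 0]. *)
Lemma gain_nonzero_of_value_positive_definite (r b c k1 k2 k : R) (F : R -> R) :
  b <> 0 -> 0 < k2 ->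
  globally_positive_definite (value r b c k1 k2 k F) -> k <> 0.
Proof.
  intros Hb Hk2 [_ Hpos] Hk; subst k.
  assert (H : 0 < value r b c k1 k2 0 F (k2, - k1)).
  { apply Hpos; intros E; injection E as E1 _; change (k2 = 0) in E1; lra. }
  rewrite value_eq in H by (assumption || ring); simpl in H.
  replace (k1 * k2 + k2 * - k1) with 0 in H by ring; lra.
Qed.

(** The value at [(1, 0)] is [r * k1 ^ 2 / (b * k2)], which has the sign of [b]. The global
    conditions do not state [0 < b], so it is recovered from positivity of [V]. *)
Lemma input_gain_pos_of_value_positive_definite (r b k1 k2 k : R) (F : R -> R) :
  0 < r -> b <> 0 -> 0 < k1 -> 0 < k2 ->
  globally_positive_definite (value r b 0 k1 k2 k F) -> 0 < b.
Proof.
  intros Hr Hb Hk1 Hk2 [_ Hpos].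
  assert (H : 0 < value r b 0 k1 k2 k F (1, 0)).
  { apply Hpos; intros E; injection E as E1; change (1 = 0) in E1; lra. }
  rewrite value_eq in H by (assumption || ring); simpl in H.
  destruct (Rlt_or_le 0 b) as [|Hle]; [assumption|exfalso].
  assert (Hinv : / b < 0) by (apply Rinv_lt_0_compat; lra).
  assert (Hq : 0 < r * k1 ^ 2 / k2).
  { apply Rdiv_lt_0_compat; [|assumption].
    apply Rmult_lt_0_compat; [assumption | apply pow_lt, Hk1]. }
  replace (r / (b * k2) * ((k1 * 1 + k2 * 0) * ((k1 * 1 + k2 * 0) * 1))
           + 2 * r / b * (k * (F 0 - F 0)))
    with (r * k1 ^ 2 / k2 * / b) in H by (field; lra).
  nra.
Qed.

(** Expanding, [(a * d - c) ^ 2 = a ^ 2 * d ^ 2 - 2 * a * c * d + c ^ 2], which is at most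
    [- 2 * c * (a * d - c) <= 0]. *)
Lemma drift_coefficients_proportional (a c d : R) :
  0 <= c * (a * d - c) -> a ^ 2 * d ^ 2 <= c ^ 2 -> c = a * d.
Proof.
  intros H1 H2.
  assert ((a * d - c) ^ 2 = 0) by (pose proof (pow2_ge_0 (a * d - c)); nra).
  assert (a * d - c = 0) by (apply Rsqr_0_uniq; rewrite Rsqr_pow2; assumption).
  lra.
Qed.

Lemma gain_identities (r a b c d q1 q2 k1 k2 k : R) :
  0 < r -> b <> 0 -> c = a * d -> 0 <= q1 -> 0 < q2 ->
  (a <> 0 -> q1 = q2 * c ^ 2 * / a ^ 2 + 2 * r * / b ^ 2 * c * (a * d - c)) ->
  (a = 0 -> q2 * d ^ 2 <= q1) ->
  k2 = sqrt (q2 / r) -> (a <> 0 -> k1 = - c * / a * k2) ->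
  (a = 0 -> k1 = sqrt (q1 / r)) -> k = / b * (d + k1 / k2) ->
  0 < k2 /\ q1 = r * k1 ^ 2 /\ q2 = r * k2 ^ 2 /\
  k * c = 0 /\ k1 * a + k2 * c = 0 /\
  (k <> 0 -> a = 0 /\ 0 < k1 /\ d ^ 2 <= (k1 / k2) ^ 2).
Proof.
  intros Hr Hb Hc Hq1 Hq2 Hq1a Hq10 Hk2 Hk1a Hk10 Hk.
  assert (Hk2pos : 0 < k2).
  { rewrite Hk2; apply sqrt_lt_R0, Rdiv_lt_0_compat; assumption. }
  assert (Hk2sq : q2 = r * k2 ^ 2).
  { rewrite Hk2, pow2_sqrt by (apply Rlt_le, Rdiv_lt_0_compat; assumption).
    field; lra. }
  split; [exact Hk2pos|].
  destruct (Req_dec a 0) as [Ha|Ha].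
  - assert (Hk1 := Hk10 Ha); specialize (Hq10 Ha).
    assert (Hdiv : 0 <= q1 / r) by (apply Rdiv_le_0_compat; assumption).
    assert (Hk1sq : q1 = r * k1 ^ 2) by (rewrite Hk1, pow2_sqrt by assumption; field; lra).
    assert (Hk1pos : 0 <= k1) by (rewrite Hk1; apply sqrt_pos).
    assert (Hc0 : c = 0) by (rewrite Hc, Ha; ring).
    assert (Hd : d ^ 2 <= (k1 / k2) ^ 2).
    { unfold Rdiv; rewrite Rpow_mult_distr, pow_inv.
      apply (Rmult_le_reg_r (k2 ^ 2)); [apply pow_lt, Hk2pos|].
      rewrite Rmult_assoc, Rinv_l by (apply pow_nonzero; lra).
      rewrite Hk2sq, Hk1sq in Hq10; apply (Rmult_le_reg_l r); [assumption|]; lra. }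
    repeat (split; [assumption|]).
    split; [rewrite Hc0; ring|]; split; [rewrite Ha, Hc0; ring|].
    intros Hk0; split; [assumption|split; [|assumption]].
    (* If [k1 = 0], the bound on [d] forces [d = 0], and then [k = 0]. *)
    destruct (Req_dec k1 0) as [E|]; [exfalso|lra].
    apply Hk0; rewrite Hk, E.
    rewrite E in Hd; unfold Rdiv in Hd; rewrite Rmult_0_l in Hd.
    assert (d = 0) by (apply Rsqr_0_uniq; rewrite Rsqr_pow2; pose proof (pow2_ge_0 d); lra).
    rewrite H; field; lra.
  (* For [a <> 0], the relation [c = a * d] makes [d + k1 / k2] vanish, so [k = 0], and it also
     removes the second term of [q1]. *)
  - assert (Hk1 : k1 = - d * k2) by (rewrite (Hk1a Ha), Hc; field; assumption).
    assert (Hk0 : k = 0) by (rewrite Hk, Hk1; field; lra).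
    split; [rewrite (Hq1a Ha), Hk1, Hk2sq, Hc; field; lra|].
    split; [assumption|].
    split; [rewrite Hk0; ring|]; split; [rewrite Hk1, Hc; ring|].
    intros H; contradiction.
Qed.

Theorem theorem4 (r a b c d beta q1 q2 : R) (f F : R -> R)
    (r_gt0 : 0 < r) (b_neq0 : b <> 0)
    (f_neq0 : exists y : R, f y <> 0)
    (f_cont : forall y : R, continuous f y)
    (f_0 : f 0 = 0)
    (F_deriv : forall y : R, is_derive F y (f y))
    (F_lpd : locally_positive_definite F)
    (c_ad_ge0 : 0 <= c * (a * d - c))
    (beta_gt0 : 0 < beta)
    (c2_le : c ^ 2 <= beta * a ^ 2)
    (a2d2_le : a ^ 2 * d ^ 2 <= c ^ 2)
    (q1_ge0 : 0 <= q1) (q2_gt0 : 0 < q2)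
    (q1_aneq0 : a <> 0 ->
       q1 = q2 * c ^ 2 * / a ^ 2 + 2 * r * / b ^ 2 * c * (a * d - c))
    (q1_a0 : a = 0 -> q2 * d ^ 2 <= q1) :
  (a = 0 /\ c = 0 \/ a <> 0 /\ c <> 0 \/ a <> 0 /\ c = 0 /\ d = 0) /\
  exists k1 k2 k : R,
    k2 = sqrt (q2 / r) /\
    (a <> 0 -> k1 = - c * / a * k2) /\
    (a = 0 -> k1 = sqrt (q1 / r)) /\
    k = / b * (d + k1 / k2) /\
    let q (x : R * R) :=
      2 * r * k1 * k2 * fst x * snd x
      + r * / b ^ 2 * (k1 ^ 2 * / k2 ^ 2 - d ^ 2) * f (snd x) ^ 2 in
    let Q (x : R * R) := q1 * fst x ^ 2 + q2 * snd x ^ 2 + q x in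
    let P :=
      {| drift1 := fun x => a * fst x + f (snd x);
         drift2 := fun x => c * fst x + d * f (snd x);
         input_gain := b;
         state_cost := Q;
         input_weight := r |} in
    let u (x : R * R) := - k1 * fst x - k2 * snd x - k * f (snd x) in
    let V (x : R * R) :=
      - r * / b * k * c * fst x ^ 2
      + r * / b * (k1 / sqrt k2 * fst x + sqrt k2 * snd x) ^ 2
      + 2 * r * / b * k * (F (snd x) - F 0) in
    let L (x : R * R) := running_cost P x (u x) in
    let local_conditions :=
      0 < b /\ k * c <= 0 /\ locally_positive_definite (fun y => k * F y) in
    let global_conditions :=
      globally_positive_definite V /\ radially_unbounded V in
    hjb_solution P V u /\
    (local_conditions ->
       local_lyapunov P u V /\
       locally (0, 0) (fun x0 : R * R =>
         forall x : R -> R * R, trajectory P u p_infty x -> x 0 = x0 ->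
         exists xmin : R * R, minimizer L xmin /\ converges_to x xmin)) /\
    (global_conditions ->
       global_lyapunov P u V /\
       forall x : R -> R * R, trajectory P u p_infty x ->
       exists xmin : R * R, minimizer L xmin /\ converges_to x xmin) /\
    (local_conditions \/ global_conditions -> convex_fun L ->
       forall x : R -> R * R, trajectory P u p_infty x ->
       converges_to x (0, 0)).
Proof.
  assert (Hc := drift_coefficients_proportional a c d c_ad_ge0 a2d2_le).
  split.
  { destruct (Req_dec a 0) as [Ha|Ha]; [left; split; [|subst a]; lra | right].
    destruct (Req_dec d 0) as [Hd|Hd]; [right; subst d; lra | left].
    split; [assumption|]; intros Hc0; subst c.
    destruct (Rmult_integral a d); lra. }
  set (k2 := sqrt (q2 / r)).
  assert (Hk1 : exists k1, (a <> 0 -> k1 = - c * / a * k2) /\ (a = 0 -> k1 = sqrt (q1 / r))).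
  { destruct (Req_dec a 0) as [Ha|Ha]; eexists; split; intros; try contradiction;
      reflexivity. }
  destruct Hk1 as (k1 & Hk1a & Hk10).
  set (k := / b * (d + k1 / k2)).
  exists k1, k2, k; repeat (split; [assumption || reflexivity|]).
  destruct (gain_identities r a b c d q1 q2 k1 k2 k)
    as (Hk2 & Hq1 & Hq2 & Hkc & Hac & Hk0); try assumption; try reflexivity.
  assert (Hk : k = / b * (d + k1 / k2)) by reflexivity.
  assert (HF0 : F 0 = 0) by exact (proj1 F_lpd).
  clearbody k2 k.
  (* Limits found in the case [a = c = 0] are turned into minimizers for the problem with its
     original coefficients. *)
  assert (Hmin : forall x, k <> 0 -> 0 < b ->
    (exists p, f p = 0 /\ converges_to x (- p / (k1 / k2), p)) ->
    exists xmin, minimizer (fun x => running_cost (problem r a b c d q1 q2 k1 k2 f) x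
                              (feedback k1 k2 k f x)) xmin /\ converges_to x xmin).
  { intros x Hkne Hb [p [Hp Hx]]; destruct (Hk0 Hkne) as (Ha & Hk1 & Hd).
    exists (- p / (k1 / k2), p); split; [|exact Hx].
    rewrite Hc, Ha, Rmult_0_l; apply equilibrium_minimizes_cost; assumption. }
  intros q Q P u V L local_conditions global_conditions.
  change P with (problem r a b c d q1 q2 k1 k2 f).
  change V with (value r b c k1 k2 k F).
  (* Either set of stability conditions yields [k <> 0], and [Hk0] then reduces the problem to
     [a = 0], hence [c = 0]. *)
  assert (Hlocal : local_conditions -> k <> 0 /\ 0 < b).
  { intros (Hb & _ & HkF); split; [|assumption].
    apply (gain_nonzero_of_locally_positive_definite k F HkF). }
  assert (Hglobal : global_conditions -> k <> 0 /\ 0 < b).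
  { intros [HV _].
    assert (Hkne : k <> 0).
    { apply (gain_nonzero_of_value_positive_definite r b c k1 k2 k F); assumption. }
    destruct (Hk0 Hkne) as (Ha & Hk1 & _); split; [assumption|].
    change V with (value r b c k1 k2 k F) in HV; rewrite Hc, Ha, Rmult_0_l in HV.
    apply (input_gain_pos_of_value_positive_definite r b k1 k2 k F); assumption. }
  split; [|split; [|split]].
  - apply feedback_solves_hjb; assumption.
  - intros Hloc; destruct (Hlocal Hloc) as [Hkne Hb].
    destruct (Hk0 Hkne) as (Ha & Hk1 & Hd).
    destruct Hloc as (_ & _ & HkF).
    assert (Hc0 : c = 0) by (rewrite Hc, Ha; ring).
    split; [split|].
    + rewrite Hc0; apply value_locally_positive_definite; assumption.
    (* The derivative of [V] is nonpositive on the whole plane, so no smaller neighbourhood has to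
       be chosen. *)
    + exists (fun _ => True); split; [apply filter_true|].
      rewrite Hc0, Ha; apply value_nonincreasing; assumption.
    + assert (Hconv := local_convergence r b d q1 q2 k1 k2 k f F r_gt0 Hb Hk1 Hk2 Hq1 Hq2
                         Hk Hd f_cont F_deriv HF0 HkF).
      revert Hconv; apply filter_imp; intros x0 Hx0 x Hx E.
      apply Hmin; [assumption | assumption | apply Hx0; [|exact E]].
      rewrite Hc0, Ha in Hx; exact Hx.
  - intros Hgl; destruct (Hglobal Hgl) as [Hkne Hb].
    destruct (Hk0 Hkne) as (Ha & Hk1 & Hd).
    destruct Hgl as [HV Hrad].
    assert (Hc0 : c = 0) by (rewrite Hc, Ha; ring).
    split; [split|].
    + exact HV.
    + rewrite Hc0, Ha; apply value_nonincreasing; assumption.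
    + change V with (value r b c k1 k2 k F) in Hrad.
      intros x Hx; rewrite Hc0 in Hrad; rewrite Hc0, Ha in Hx.
      apply Hmin; [assumption | assumption |].
      apply (global_convergence r b d q1 q2 k1 k2 k f F x); assumption.
  - intros Hcond Hconv x Hx.
    assert (Hkb : k <> 0 /\ 0 < b) by (destruct Hcond; auto).
    destruct Hkb as [Hkne Hb]; destruct (Hk0 Hkne) as (Ha & Hk1 & Hd).
    assert (Hc0 : c = 0) by (rewrite Hc, Ha; ring).
    change L with (fun x => running_cost (problem r a b c d q1 q2 k1 k2 f) x
                              (feedback k1 k2 k f x)) in Hconv.
    rewrite Hc0, Ha in Hconv, Hx.
    apply (convex_cost_convergence r b d q1 q2 k1 k2 k f F x); assumption.
Qed.
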